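(* An $m\times n$ net in $\mathbb{R}^d$ is deformable if and only if one of the following conditions holds: (i) in each $1\times 2$ sub-net or in each $2\times 1$ sub-net, the two faces are affine symmetric with respect to their common edge (that is, either this holds for all $1\times 2$ sub-nets, or it holds for all $2\times 1$ sub-nets); (ii) each pair of faces with a common edge has equal opposite ratios with respect to that edge.
   Context: An $m\times n$ net is a collection of $(m+1)(n+1)$ points $P_{ij}\in\mathbb{R}^d$, $0\le i\le m$, $0\le j\le n$ (not necessarily distinct), such that for all $0\le i<m$, $0\le j<n$ the points $P_{ij},P_{i+1,j},P_{i+1,j+1},P_{i,j+1}$ are consecutive vertices of a convex (planar, non-degenerate) quadrilateral. These quadrilaterals are the faces and their sides are the edges. Faces and edges are labeled by the indices of their vertices: those with different labels are viewed as distinct even if they coincide as subsets of $\mathbb{R}^d$, and a common edge of two faces must have common labels with both. Faces or edges of two $m\times n$ nets spanned by points with the same indices are called corresponding. An $a\times b$ sub-net of an $m\times n$ net $P_{ij}$ is the $a\times b$ net formed by the points $P_{ij}$ with $p\le i\le p+a$, $q\le j\le q+b$, for some integers $0\le p\le m-a$ and $0\le q\le n-b$. Two $m\times n$ nets are parallel (Combescure transformations of each other) if their corresponding edges are parallel. They are congruent if there is an isometry of $\mathbb{R}^d$ taking each point of the first net to the point of the second net with the same indices. An $m\times n$ net is deformable if it is contained in a continuous family of non-congruent parallel $m\times n$ nets with the same areas of corresponding faces. Two quadrilaterals in $\mathbb{R}^d$ with a common side are affine symmetric with respect to the common side if there is an affine map taking the first quadrilateral to the second one and keeping the points of the common side fixed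 (labels are ignored). For a convex quadrilateral $ABCD$ with diagonals meeting at $Q$, the opposite ratio of $ABCD$ with respect to the side $AB$ is $\mathrm{Area}(AQB)/\mathrm{Area}(CQD)$. *)

(* Defs.v *)
From HB Require Import structures.
From mathcomp Require Import all_boot all_order all_algebra.
From mathcomp Require Import all_classical all_reals all_analysis.
Import Order.TTheory GRing.Theory Num.Theory.
Import numFieldNormedType.Exports.

Set Implicit Arguments.
Unset Strict Implicit.
Unset Printing Implicit Defensive.

Local Open Scope classical_set_scope.
Local Open Scope ring_scope.

Section Euclidean.
Variables (R : realType) (d : nat).
Implicit Types (u v A B C D : 'rV[R]_d).

(* The library norm on row vectors is the sup norm, so the Euclidean
   structure is spelled out here. *)
Definition dot u v : R := \sum_(i < d) u 0 i * v 0 i.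

Definition edist u v : R := Num.sqrt (dot (u - v) (u - v)).

Definition euclidean_isometry (f : 'rV[R]_d -> 'rV[R]_d) : Prop :=
  forall u v, edist (f u) (f v) = edist u v.

Definition parallel_vec u v : Prop := (\rank (col_mx u v) <= 1)%N.

Definition collinear A B C : Prop := parallel_vec (B - A) (C - A).

Definition seg A B : set 'rV[R]_d :=
  [set (1 - t) *: A + t *: B | t in `[0, 1]%classic].

(* A, B, C, D are consecutive vertices of a convex, non-degenerate
   quadrilateral: no three of them are collinear and the diagonals AC and BD
   meet; the latter also forces the four points to be coplanar. *)
Definition convex_quad A B C D : Prop :=
  [/\ ~ collinear A B C, ~ collinear B C D, ~ collinear C D A,
      ~ collinear D A B & seg A C `&` seg B D !=set0].

(* Half of the square root of the Gram determinant of two sides. *)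
Definition tri_area A B C : R :=
  Num.sqrt (dot (B - A) (B - A) * dot (C - A) (C - A)
            - dot (B - A) (C - A) ^+ 2) / 2.

(* The area of a convex quadrilateral, cut along the diagonal AC. *)
Definition quad_area A B C D : R := tri_area A B C + tri_area A C D.

(* For a convex quadrilateral the diagonals meet in exactly one point; the
   default value 0 is irrelevant. *)
Definition diag_point A B C D : 'rV[R]_d := xget 0 (seg A C `&` seg B D).

Definition opposite_ratio A B C D : R :=
  let Q := diag_point A B C D in tri_area A Q B / tri_area C Q D.

(* The convex hull of the vertices. *)
Definition quad_region A B C D : set 'rV[R]_d :=
  smallest (@convex_set R 'rV[R]_d) [set A; B; C; D].

(* Affine symmetry of the quadrilaterals ABCD and ABC'D' with respect to
   their common side AB. *)
Definition affine_symmetric A B C D C' D' : Prop :=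
  exists (M : 'M[R]_d) (b : 'rV[R]_d),
    let f := fun x : 'rV[R]_d => x *m M + b in
    (forall x, seg A B x -> f x = x) /\
    f @` quad_region A B C D = quad_region A B C' D'.

Definition equal_opposite_ratios A B C D C' D' : Prop :=
  opposite_ratio A B C D = opposite_ratio A B C' D'.

End Euclidean.

Definition grid (R : realType) (d m n : nat) : Type :=
  'I_m.+1 -> 'I_n.+1 -> 'rV[R]_d.

(* The point of index (i, j); only used for i <= m and j <= n. *)
Definition pt (R : realType) (d m n : nat) (P : grid R d m n) (i j : nat) :
  'rV[R]_d := P (inord i) (inord j).

Section Nets.
Variables (R : realType) (d m n : nat).
Implicit Types P Q : grid R d m n.

Definition is_net P : Prop :=
  forall i j, (i < m)%N -> (j < n)%N ->
    convex_quad (pt P i j) (pt P i.+1 j) (pt P i.+1 j.+1) (pt P i j.+1).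

Definition parallel_nets P Q : Prop :=
  (forall i j, (i < m)%N -> (j <= n)%N ->
     parallel_vec (pt P i.+1 j - pt P i j) (pt Q i.+1 j - pt Q i j)) /\
  (forall i j, (i <= m)%N -> (j < n)%N ->
     parallel_vec (pt P i j.+1 - pt P i j) (pt Q i j.+1 - pt Q i j)).

Definition face_area P (i j : nat) : R :=
  quad_area (pt P i j) (pt P i.+1 j) (pt P i.+1 j.+1) (pt P i j.+1).

Definition same_face_areas P Q : Prop :=
  forall i j, (i < m)%N -> (j < n)%N -> face_area P i j = face_area Q i j.

Definition congruent_nets P Q : Prop :=
  exists2 f : 'rV[R]_d -> 'rV[R]_d, euclidean_isometry f &
    forall i j, Q i j = f (P i j).

(* The family is parametrized by [0, 1] and its members are pairwise
   non-congruent; P may be any member of the family. *)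
Definition deformable P : Prop :=
  exists N : R -> grid R d m n,
    [/\ exists2 t : R, t \in `[0, 1] & forall i j, N t i j = P i j,
        forall i j, {within `[0, 1], continuous (fun t : R => N t i j)},
        forall t : R, t \in `[0, 1] -> is_net (N t),
        forall s t : R, s \in `[0, 1] -> t \in `[0, 1] ->
          parallel_nets (N s) (N t) /\ same_face_areas (N s) (N t)
      & forall s t : R, s \in `[0, 1] -> t \in `[0, 1] -> s != t ->
          ~ congruent_nets (N s) (N t)].

Definition subnet (a b p q : nat) P : grid R d a b :=
  fun i j => pt P (p + i) (q + j).

End Nets.

Arguments subnet {R d m n} a b p q P.

Section Adjacent.
Variables (R : realType) (d : nat).

(* A property of two quadrilaterals ABCD and ABC'D' with common side AB, as a
   function of A, B, C, D, C', D', evaluated at the two faces of a net of size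
   1 x 2 (resp. 2 x 1). *)
Definition faces12 (S : 'rV[R]_d -> 'rV[R]_d -> 'rV[R]_d -> 'rV[R]_d ->
    'rV[R]_d -> 'rV[R]_d -> Prop) (N : grid R d 1 2) : Prop :=
  S (pt N 0 1) (pt N 1 1) (pt N 1 0) (pt N 0 0) (pt N 1 2) (pt N 0 2).

Definition faces21 (S : 'rV[R]_d -> 'rV[R]_d -> 'rV[R]_d -> 'rV[R]_d ->
    'rV[R]_d -> 'rV[R]_d -> Prop) (N : grid R d 2 1) : Prop :=
  S (pt N 1 0) (pt N 1 1) (pt N 0 1) (pt N 0 0) (pt N 2 1) (pt N 2 0).

Variables (m n : nat).
Implicit Types P : grid R d m n.

(* Two distinct faces with a common edge are exactly the faces of a sub-net of
   size 1 x 2 or 2 x 1. *)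
Definition each_subnet12 (T : grid R d 1 2 -> Prop) P : Prop :=
  forall p q, (p + 1 <= m)%N -> (q + 2 <= n)%N -> T (subnet 1 2 p q P).

Definition each_subnet21 (T : grid R d 2 1 -> Prop) P : Prop :=
  forall p q, (p + 2 <= m)%N -> (q + 1 <= n)%N -> T (subnet 2 1 p q P).

End Adjacent.

(* Main.v *)
Require Import Defs.
From mathcomp Require Import all_boot all_order all_algebra.
From mathcomp Require Import all_classical all_reals all_analysis.
From mathcomp Require Import ring lra.
Import Order.TTheory GRing.Theory Num.Theory.
Import numFieldNormedType.Exports.

(* Idea. Up to translation, the parallel quadrilaterals of a convex quadrilateral
   with the same signed area form a branch of a hyperbola. In the parameter
   [X = e ^ t] of that branch, opposite sides are scaled by [ch t + c sh t] and
   [ch t + c^-1 sh t], and the two slopes of adjacent sides have opposite signs;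
   so a face has two positive shape parameters [a] and [b], the opposite ratios
   are their inverse squares, and two faces are affine symmetric with respect to
   a common side if and only if their parameters match. A deformation is thus a
   family of times [X i j], one per face, that give equal scales to common edges.

   Around an interior vertex, suppose that two consecutive of the four edges have
   different slopes in their two faces. Then, over the field of rational
   functions of the time of the face spanned by these two edges, the scales of
   the other two edges lie in two independent quadratic extensions, whereas the
   opposite face gives a quadratic relation between them in which the product
   term does not vanish: a contradiction. Hence a single edge with different
   slopes forces all the edges that are transverse to it in the net to have
   equal slopes, which is case (i), and if there is no such edge we are in case
   (ii). *)

Set Implicit Arguments.
Unset Strict Implicit.
Unset Printing Implicit Defensive.

Local Open Scope classical_set_scope.
Local Open Scope ring_scope.

(** The field theory is carried out on values. A deformation only provides, for infinitely many
    times, real numbers that satisfy the conics, with no control over the signs of the square roots;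
    so each independence statement is reached by squaring until a polynomial with infinitely many
    zeros appears. The variable is [x ^+ 2], because [x * sc a x] is linear in it. The two radicands
    are told apart by their outer coefficients: the constant one is below the leading one in the
    first radicand and above it in the second. When a slope equals 1, its conic is linear in the
    unknown scale and the extension collapses; poles of rational functions then replace square
    roots. Affine symmetry asks for two parameters to match, while a vertex yields only one. The
    other comes from two strips of faces that share their times ([sc_pair]). Finally [sc c] is not
    injective on positive times when [c < 1], so equal scales give equal times only near 1. Hence a
    deformation is studied only close to the given net. *)

(* Scale factor [ch t + c sh t], with [X = e ^ t], of a side of slope [c]. *)
Definition sc (R : realType) (c X : R) : R := ((1 + c) * X + (1 - c) / X) / 2.

(* The relation between the scales [u] and [z] of two adjacent sides of a face
   with parameters [a] and [b]. *)
Definition conic (R : realType) (a b u z : R) : Prop :=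
  (b ^+ 2 - 1) * u ^+ 2 + 2 * (a * b + 1) * (u * z) + (a ^+ 2 - 1) * z ^+ 2
  = (a + b) ^+ 2.

Lemma conic_sym (R : realType) (a b u z : R) : conic a b u z -> conic b a z u.
Proof. by rewrite /conic => h; rewrite [b + a]addrC -h; ring. Qed.

(** Both scales are linear forms in [x] and [x^-1]; inverting this linear change of variables turns
    the equation [x * x^-1 = 1] into the conic. *)
Lemma sc_conic (R : realType) (a b x : R) : x != 0 ->
  conic a b (sc a x) (sc b x^-1).
Proof. by move=> x0; rewrite /conic /sc; field. Qed.

(** * The four faces around an interior vertex *)

Lemma infinite_image (T U : Type) (D : set T) (f : T -> U) :
  {in D &, injective f} -> infinite_set D -> infinite_set (f @` D).
Proof. by move=> fi; rewrite (eq_finite_set (inj_card_eq fi)). Qed.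

Lemma poly_infinite_roots (R : realType) (A : set R) (p : {poly R}) :
  infinite_set A -> (forall x, A x -> p.[x] = 0) -> p = 0.
Proof.
move=> infA rA; apply/eqP; apply/negP => /negP p0.
have [B BA sB] := infinite_set_fset (size p) infA.
have := max_poly_roots p0 (rs := finmap.enum_fset B); rewrite finmap.fset_uniq.
have -> : all (root p) (finmap.enum_fset B).
  by apply/allP => x xB; apply/rootP/rA/BA.
by move=> /(_ isT isT); rewrite ltnNge => /negP; apply.
Qed.

(** As [q ^+ 2] divides [p ^+ 2], [q] divides [p], and the quadratic would be the square of a linear
    polynomial, with zero discriminant. *)
Lemma nonsquare_poly (R : realType) (c2 c1 c0 : R) (p q : {poly R}) :
  c1 ^+ 2 != 4 * c2 * c0 ->
  p ^+ 2 = q ^+ 2 * (c2 *: 'X ^+ 2 + c1 *: 'X + c0%:P) -> q = 0.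
Proof.
move=> disc pq; apply/eqP; apply/negP => /negP q0.
have /dvdpP [r rE] : q %| p by rewrite -(@dvdp_pexp2r _ _ _ 2) // pq dvdp_mulr.
have rr : r ^+ 2 = c2 *: 'X ^+ 2 + c1 *: 'X + c0%:P.
  apply: (mulfI (_ : q ^+ 2 != 0)); first by rewrite expf_neq0.
  by rewrite -pq rE; ring.
have sr : (size r <= 2)%N.
  have : (size (r ^+ 2) <= 3)%N.
    rewrite rr (leq_trans (size_polyD _ _)) // geq_max.
    rewrite (leq_trans (size_polyC_leq1 _)) // andbT.
    rewrite (leq_trans (size_polyD _ _)) // geq_max.
    by rewrite !(leq_trans (size_scale_leq _ _)) // ?size_polyXn ?size_polyX.
  rewrite expr2; case: (eqVneq r 0) => [->|r0]; first by rewrite size_poly0.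
  by rewrite size_mul //; case: (size r) => [|[|[|k]]] //=; rewrite !addSn !addnS.
have rE2 : r = r`_1 *: 'X + (r`_0)%:P.
  apply/polyP => i; rewrite !(coefD, coefZ, coefX, coefC).
  case: i => [|[|i]] /=; rewrite ?mulr0 ?mulr1 ?add0r ?addr0 //.
  by rewrite nth_default // (leq_trans sr).
move: rr; rewrite {1}rE2 => rr.
have h (t : R) : (r`_1 * t + r`_0) ^+ 2 = c2 * t ^+ 2 + c1 * t + c0.
  have := congr1 (fun p => p.[t]) rr.
  by rewrite /= !(hornerE, horner_exp).
move: disc => /eqP; apply.
have := h 0; have := h 1; have := h (-1); set s1 := r`_1; set s0 := r`_0.
move=> h1 h2 h3.
have -> : c0 = s0 ^+ 2 by lra.
have -> : c2 = s1 ^+ 2 by lra.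
have -> : c1 = 2 * s1 * s0 by lra.
by ring.
Qed.

Definition lin (R : realType) (A B : R) : {poly R} := A *: 'X + B%:P.

Lemma lin_eval (R : realType) (A B t : R) : (lin A B).[t] = A * t + B.
Proof. by rewrite /lin !hornerE. Qed.

(** If [t = x ^+ 2], [x * u = A * t + B] and [y ^+ 2 = u ^+ 2 + k], the value at [t] is
    [(x * y) ^+ 2]: this is the radicand met when a conic is solved, cleared of denominators. Its
    discriminant is [k * (k + 4 * (A * B))], the source of the two conditions that recur below. *)
Definition dsc (R : realType) (A B k : R) : {poly R} := lin A B ^+ 2 + k *: 'X.

Lemma dsc_eval (R : realType) (A B k t : R) :
  (dsc A B k).[t] = (A * t + B) ^+ 2 + k * t.
Proof. by rewrite /dsc hornerD hornerZ hornerX horner_exp lin_eval. Qed.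

Lemma dsc_deriv (R : realType) (A B k t : R) :
  (deriv (dsc A B k)).[t] = 2 * (A * t + B) * A + k.
Proof.
rewrite /dsc derivD derivZ derivX expr2 derivM /lin derivD derivZ derivX derivC.
by rewrite !hornerE; ring.
Qed.

Lemma dsc_nonsquare (R : realType) (A B k : R) (p q : {poly R}) :
  k != 0 -> k + 4 * (A * B) != 0 -> p ^+ 2 = q ^+ 2 * dsc A B k -> q = 0.
Proof.
move=> k0 k1 pq.
apply: (@nonsquare_poly R (A ^+ 2) (2 * (A * B) + k) (B ^+ 2) p q).
  rewrite -subr_eq0.
  have -> : (2 * (A * B) + k) ^+ 2 - 4 * A ^+ 2 * B ^+ 2 = k * (k + 4 * (A * B)).
    by ring.
  by rewrite mulf_neq0.
rewrite pq /dsc /lin; congr (_ * _).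
rewrite -!mul_polyC !polyCD !polyCM.
have -> : 2%:P = 2 :> {poly R} by rewrite polyC_natr.
by ring.
Qed.

(** At the root of [lin a' b'] the right side vanishes to second order. If [lin a b] did not vanish
    there, this point would be a double root of [dsc A B k], whose discriminant is not zero. *)
Lemma dsc_double_root (R : realType) (A B k A' B' k' a b a' b' : R) :
  k != 0 -> k + 4 * (A * B) != 0 ->
  dsc A B k * lin a b ^+ 2 = dsc A' B' k' * lin a' b' ^+ 2 ->
  a' != 0 -> a * b' - b * a' = 0.
Proof.
move=> k0 k1 E a'0; apply/eqP; apply/negP => /negP det.
have ev t := congr1 (fun p => p.[t]) E.
have ev' t := congr1 (fun p => (deriv p).[t]) E.
pose t := - b' / a'.
have lt : a' * t + b' = 0 by rewrite /t; field.
have l0 : a * t + b != 0.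
  have -> : a * t + b = - (a * b' - b * a') / a' by rewrite /t; field.
  by rewrite mulf_neq0 ?oppr_eq0 ?invr_eq0.
have r1 : (A * t + B) ^+ 2 + k * t = 0.
  have := ev t; rewrite /= !hornerM !dsc_eval !lin_eval lt !mulr0.
  by move=> /eqP; rewrite !mulf_eq0 (negbTE l0) !orbF => /eqP.
have r2 : 2 * (A * t + B) * A + k = 0.
  have := ev' t; rewrite /= !expr2 !derivM !hornerD !hornerM !dsc_eval !lin_eval.
  rewrite !hornerD !hornerM !lin_eval lt r1 !(mulr0, mul0r, addr0) dsc_deriv => /eqP.
  by rewrite !mulf_eq0 (negbTE l0) !orbF => /eqP.
(* For a quadratic, the squared derivative minus four times the leading coefficient times the value
   is the discriminant at every point. *)
have : (2 * (A * t + B) * A + k) ^+ 2 - 4 * A ^+ 2 * ((A * t + B) ^+ 2 + k * t)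
   = k * (k + 4 * (A * B)) by ring.
rewrite r1 r2 expr0n mulr0 subr0 => /esym/eqP.
by rewrite mulf_eq0 (negbTE k0) (negbTE k1).
Qed.

(** The two linear factors must share their root, so they cancel up to a constant [c] and the
    radicands become proportional with the positive ratio [c ^+ 2]. This contradicts the opposite
    orders of their leading and constant coefficients. *)
Lemma dsc_coprime (R : realType) (A B k A' B' k' a b a' b' : R) :
  k != 0 -> k + 4 * (A * B) != 0 -> k' != 0 -> k' + 4 * (A' * B') != 0 ->
  B ^+ 2 < A ^+ 2 -> A' ^+ 2 < B' ^+ 2 ->
  lin a b != 0 ->
  dsc A B k * lin a b ^+ 2 = dsc A' B' k' * lin a' b' ^+ 2 -> lin a' b' = 0.
Proof.
move=> k0 k1 k'0 k'1 AB A'B' l0 E; apply/eqP; apply/negP => /negP l'0.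
have det : a * b' - b * a' = 0.
  have [a'0|] := eqVneq a' 0; last exact: dsc_double_root E.
  have [a0|a0] := eqVneq a 0; first by rewrite a0 a'0; ring.
  have := dsc_double_root k'0 k'1 (esym E) a0.
  by move=> h; rewrite -[RHS]oppr0 -h; ring.
have [c c0 cE] : exists2 c : R, c != 0 & lin a' b' = c *: lin a b.
  have [a0|a0] := eqVneq a 0.
    have b0 : b != 0.
      by apply: contraNneq l0 => b0; rewrite /lin a0 b0 scale0r add0r polyC0.
    have a'0 : a' = 0.
      by move/eqP: det; rewrite a0 mul0r sub0r oppr_eq0 mulf_eq0 (negbTE b0) => /eqP.
    exists (b' / b).
      rewrite mulf_neq0 ?invr_eq0 //; apply: contraNneq l'0 => b'0.
      by rewrite /lin a'0 b'0 scale0r add0r polyC0.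
    by rewrite /lin a0 a'0 !scale0r !add0r -!mul_polyC -polyCM divfK.
  have bE : b' = (a' / a) * b.
    apply: (mulfI a0); rewrite mulrA [a * (_ / _)]mulrC divfK //.
    by apply/eqP; rewrite -subr_eq0 [a' * b]mulrC det.
  exists (a' / a).
    rewrite mulf_neq0 ?invr_eq0 //; apply: contraNneq l'0 => a'0.
    by rewrite /lin bE a'0 !mul0r scale0r add0r polyC0.
  by rewrite /lin scalerDr scalerA divfK // -[_ *: b%:P]mul_polyC -polyCM -bE.
have EE : dsc A B k = c ^+ 2 *: dsc A' B' k'.
  apply: (mulIf (_ : lin a b ^+ 2 != 0)); first by rewrite expf_neq0.
  by rewrite E cE exprZn -!scalerAl -scalerAr.
have ev t := congr1 (fun p => p.[t]) EE.
have := ev 0; have := ev 1; have := ev (-1).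
rewrite /= !hornerZ !dsc_eval => h1 h2 h3.
have eB : B ^+ 2 = c ^+ 2 * B' ^+ 2 by lra.
have eA : A ^+ 2 = c ^+ 2 * A' ^+ 2 by lra.
have c2 : 0 < c ^+ 2 by rewrite exprn_even_gt0.
by move: AB; rewrite eA eB ltr_pM2l // ltNge (ltW A'B').
Qed.

(** Squaring removes the uncontrolled sign of [s] and leaves a polynomial identity that would make
    the radicand a square. *)
Lemma quadratic_independent (R : realType) (D : set R) (A B k : R)
    (e n : {poly R}) :
  infinite_set D -> k != 0 -> k + 4 * (A * B) != 0 ->
  (forall t, D t -> exists2 s : R, s ^+ 2 = (dsc A B k).[t] &
     e.[t] + n.[t] * s = 0) ->
  e = 0 /\ n = 0.
Proof.
move=> infD k0 k1 H.
have en : e ^+ 2 = n ^+ 2 * dsc A B k.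
  apply/eqP; rewrite -subr_eq0; apply/eqP.
  apply: (poly_infinite_roots infD) => t /H [s sE ens].
  move: sE ens; move: (dsc A B k) => d sE ens.
  rewrite !hornerE -sE; move/eqP: ens; rewrite addr_eq0 => /eqP ->.
  by ring.
have n0 := dsc_nonsquare k0 k1 en; split=> //.
by apply/eqP; rewrite -sqrf_eq0 en n0 expr0n mul0r.
Qed.

(** * Biquadratic extensions and the rigidity of a vertex *)

Lemma biquadratic_independent (R : realType) (D : set R)
    (A B k A' B' k' f1 f0 g1 g0 h : R) (e : {poly R}) :
  infinite_set D ->
  k != 0 -> k + 4 * (A * B) != 0 -> k' != 0 -> k' + 4 * (A' * B') != 0 ->
  B ^+ 2 < A ^+ 2 -> A' ^+ 2 < B' ^+ 2 ->
  lin f1 f0 != 0 -> lin g1 g0 != 0 -> h != 0 ->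
  (forall t, D t -> exists y s : R,
    [/\ y ^+ 2 = (dsc A B k).[t], s ^+ 2 = (dsc A' B' k').[t] &
      e.[t] + (lin f1 f0).[t] * y + (lin g1 g0).[t] * s + h * (y * s) = 0]) ->
  False.
Proof.
move=> infD k0 k1 k'0 k'1 AB AB' f_neq0 g_neq0 h0 H.
set f := lin f1 f0 in f_neq0 H; set g := lin g1 g0 in g_neq0 H.
set d := dsc A B k in H; set d' := dsc A' B' k' in H.
(* Moving the terms in [y] to one side and squaring leaves a relation in [s] alone; these are its
   two coefficients. *)
have [mu0 nu0] : d * f ^+ 2 + (h ^+ 2)%:P * (d * d') - e ^+ 2 - g ^+ 2 * d' = 0
    /\ 2%:P * (h%:P * f * d - e * g) = 0.
  apply: (quadratic_independent infD k'0 k'1) => t /H [y [s [yE sE E]]].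
  exists s => //; clear H infD k'0 k'1; clearbody d d' f g.
  rewrite !hornerE /= -yE -sE.
  have : (e.[t] + g.[t] * s) ^+ 2 = ((f.[t] + h * s) * y) ^+ 2.
    by rewrite -sqrrN; congr (_ ^+ 2); lra.
  move=> EE; transitivity (((f.[t] + h * s) * y) ^+ 2 - (e.[t] + g.[t] * s) ^+ 2).
    by ring.
  by rewrite EE subrr.
have hfd : h%:P * f * d = e * g.
  move/eqP: nu0; rewrite mulf_eq0 polyC_eq0 pnatr_eq0 /= subr_eq0.
  by move=> /eqP.
(* Elimination of [e] between the two vanishing coefficients happens to factor. The first factor
   would make [d] a square, the second would make [d] and [d'] agree up to squares. *)
have : (d * (h ^+ 2)%:P - g ^+ 2) * (d' * g ^+ 2 - d * f ^+ 2) = 0.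
  have -> : (d * (h ^+ 2)%:P - g ^+ 2) * (d' * g ^+ 2 - d * f ^+ 2) =
    (d * f ^+ 2 + (h ^+ 2)%:P * (d * d') - e ^+ 2 - g ^+ 2 * d') * g ^+ 2
    - (h%:P * f * d - e * g) * (h%:P * f * d + e * g).
    by rewrite polyC_exp; ring.
  by rewrite mu0 hfd subrr !mul0r subr0.
move=> /eqP; rewrite mulf_eq0 => /orP[]; rewrite subr_eq0 => /eqP E.
  have : h%:P = 0.
    by apply: (dsc_nonsquare k0 k1 (p := g)); rewrite -E polyC_exp mulrC.
  by move=> /eqP; rewrite polyC_eq0 (negbTE h0).
by move: g_neq0; rewrite /g (dsc_coprime k0 k1 k'0 k'1 AB AB' f_neq0 (esym E)) eqxx.
Qed.

Lemma sc_lin (R : realType) (a x : R) : x != 0 ->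
  x * sc a x = (1 + a) / 2 * x ^+ 2 + (1 - a) / 2.
Proof. by move=> x0; rewrite /sc; field. Qed.

Lemma sc_linV (R : realType) (a x : R) : x != 0 ->
  x * sc a x^-1 = (1 - a) / 2 * x ^+ 2 + (1 + a) / 2.
Proof. by move=> x0; rewrite /sc; field. Qed.

Lemma lin_combination_neq0 (R : realType) (A B A' B' f g : R) :
  A * B' - B * A' != 0 -> (f != 0) || (g != 0) ->
  lin (f * A' + g * A) (f * B' + g * B) != 0.
Proof.
move=> det fg; apply/negP => /eqP l0.
have := congr1 (fun p => p.[0]) l0; have := congr1 (fun p => p.[1]) l0.
rewrite /= !lin_eval !horner0 => h1 h2.
have : f * (A * B' - B * A') = 0.
  have -> : f * (A * B' - B * A') =
    A * (f * B' + g * B) - B * (f * A' + g * A) by ring.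
  have -> : f * B' + g * B = 0 by lra.
  have -> : f * A' + g * A = 0 by lra.
  by rewrite !mulr0 subrr.
have : g * (A * B' - B * A') = 0.
  have -> : g * (A * B' - B * A') =
    B' * (f * A' + g * A) - A' * (f * B' + g * B) by ring.
  have -> : f * B' + g * B = 0 by lra.
  have -> : f * A' + g * A = 0 by lra.
  by rewrite !mulr0 subrr.
move=> /eqP; rewrite mulf_eq0 (negbTE det) orbF => /eqP g0.
move=> /eqP; rewrite mulf_eq0 (negbTE det) orbF => /eqP f0.
by move: fg; rewrite f0 g0 eqxx.
Qed.

(** Completion of the square in [v]; the radicand simplifies because [(a * b + 1) ^+ 2 - (a ^+ 2 -
    1) * (b ^+ 2 - 1) = (a + b) ^+ 2]. *)
Lemma conic_root (R : realType) (a b u v : R) : 0 < a -> 0 < b ->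
  conic a b u v ->
  (((a ^+ 2 - 1) * v + (a * b + 1) * u) / (a + b)) ^+ 2 = u ^+ 2 + (a ^+ 2 - 1).
Proof.
move=> a0 b0; rewrite /conic => E.
have ab : a + b != 0 by rewrite lt0r_neq0 // addr_gt0.
have E2 : ((a ^+ 2 - 1) * v + (a * b + 1) * u) ^+ 2 =
  (a + b) ^+ 2 * (u ^+ 2 + (a ^+ 2 - 1)).
  rewrite [RHS]mulrDr -{2}E; ring.
by rewrite expr_div_n E2 mulrAC divff ?mul1r // expf_neq0.
Qed.

Lemma infinite_sqr (R : realType) (D : set R) : infinite_set D ->
  (forall x, D x -> 0 < x) -> infinite_set [set x ^+ 2 | x in D].
Proof.
move=> infD D0; apply: infinite_image infD => x y /set_mem/D0 x0 /set_mem/D0 y0 /eqP.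
by rewrite eqrXn2 ?ltW // => /eqP.
Qed.

(* Over the field of rational functions in [x ^+ 2], the two square roots that
   express [v] and [w] generate a biquadratic extension, and the third conic has
   the non-zero coefficient [h] on their product. *)
Lemma vertex_generic (R : realType) (D : set R)
    (a1 b1 a2 b2 a3 b3 a4 b4 : R) :
  0 < a1 -> 0 < b1 -> 0 < a2 -> 0 < b2 -> 0 < a3 -> 0 < b3 -> 0 < a4 -> 0 < b4 ->
  infinite_set D ->
  (forall x, D x -> 0 < x /\ exists v w,
    [/\ conic a2 b2 (sc a1 x) v, conic b4 a4 (sc b1 x^-1) w & conic b3 a3 v w]) ->
  a1 != a2 -> b1 != b4 -> a2 ^+ 2 - 1 != 0 -> b4 ^+ 2 - 1 != 0 -> False.
Proof.
move=> a10 b10 a20 b20 a30 b30 a40 b40 infD H a12 b14 k0 l0.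
have infD2 := infinite_sqr infD (fun x Dx => (H x Dx).1).
pose q2 := a2 + b2; pose p2 := a2 * b2 + 1.
pose q4 := b4 + a4; pose p4 := b4 * a4 + 1; pose p3 := b3 * a3 + 1.
pose q3 := b3 + a3.
have q20 : 0 < q2 by rewrite addr_gt0.
have q40 : 0 < q4 by rewrite addr_gt0.
have p20 : 0 < p2 by rewrite addr_gt0 ?mulr_gt0.
have p40 : 0 < p4 by rewrite addr_gt0 ?mulr_gt0.
have p30 : 0 < p3 by rewrite addr_gt0 ?mulr_gt0.
pose k := a2 ^+ 2 - 1; pose l := b4 ^+ 2 - 1.
pose k3 := b3 ^+ 2 - 1; pose l3 := a3 ^+ 2 - 1.
pose A := (1 + a1) / 2; pose B := (1 - a1) / 2.
pose A' := (1 - b1) / 2; pose B' := (1 + b1) / 2.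
have det : A * B' - B * A' != 0.
  have -> : A * B' - B * A' = (a1 + b1) / 2 by rewrite /A /B /A' /B'; field.
  by rewrite mulf_neq0 ?invr_eq0 ?pnatr_eq0 // lt0r_neq0 // addr_gt0.
(* Multiply the third conic by [(k * l) ^+ 2] and replace [k * v] by [q2 * y - p2 * u] and [l * w]
   by [q4 * s - p4 * z]. Then [f1] and [f2] are the coefficients of [z * y] and [u * y], [g1] and
   [g2] those of [z * s] and [u * s], and [h] that of [y * s]; [e] collects the rest. A further
   factor [x ^+ 2] makes everything a polynomial in [x ^+ 2], with roots [x * y] and [x * s]. *)
pose f1 := - (2 * p3 * k * l * q2 * p4); pose f2 := - (2 * l3 * l ^+ 2 * q2 * p2).
pose g1 := - (2 * k3 * k ^+ 2 * q4 * p4); pose g2 := - (2 * p3 * k * l * q4 * p2).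
pose h := 2 * p3 * k * l * q2 * q4.
pose pu := lin A B; pose pz := lin A' B'.
pose e := (k3 * k ^+ 2)%:P * ((q4 ^+ 2 + p4 ^+ 2) *: pz ^+ 2 + (q4 ^+ 2 * l) *: 'X)
  + (2 * p3 * k * l * p4 * p2) *: (pz * pu)
  + (l3 * l ^+ 2)%:P * ((q2 ^+ 2 + p2 ^+ 2) *: pu ^+ 2 + (q2 ^+ 2 * k) *: 'X)
  - (q3 ^+ 2 * l ^+ 2 * k ^+ 2) *: 'X.
have sqlt (c : R) : 0 < c -> ((1 - c) / 2) ^+ 2 < ((1 + c) / 2) ^+ 2.
  by move=> c0; rewrite -subr_gt0; have -> : ((1 + c) / 2) ^+ 2 -
    ((1 - c) / 2) ^+ 2 = c by field.
have neqs (c c' : R) : 0 < c -> 0 < c' -> c != c' ->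
    c' ^+ 2 - 1 + (1 - c ^+ 2) != 0.
  move=> c0 c'0 cc'; have -> : c' ^+ 2 - 1 + (1 - c ^+ 2) = c' ^+ 2 - c ^+ 2 by ring.
  by rewrite subr_eq0 eqrXn2 // ?ltW // eq_sym.
apply: (@biquadratic_independent R _ A B k A' B' l (f1 * A' + f2 * A)
  (f1 * B' + f2 * B) (g1 * A' + g2 * A) (g1 * B' + g2 * B) h e infD2) => //.
(* The second factor of the discriminant is thus [a2 ^+ 2 - a1 ^+ 2]: here the difference of the
   slopes enters. *)
- have -> : 4 * (A * B) = 1 - a1 ^+ 2 by rewrite /A /B; field.
  exact: neqs.
- have -> : 4 * (A' * B') = 1 - b1 ^+ 2 by rewrite /A' /B'; field.
  exact: neqs.
- exact: sqlt.
- exact: sqlt.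
- by rewrite lin_combination_neq0 // oppr_eq0 !mulf_neq0 ?pnatr_eq0 // lt0r_neq0.
- apply: lin_combination_neq0 => //; apply/orP; right.
  by rewrite oppr_eq0 !mulf_neq0 ?pnatr_eq0 // lt0r_neq0.
- by rewrite !mulf_neq0 ?pnatr_eq0 // lt0r_neq0.
move=> _ [x Dx <-]; have [x0 [v [w [C2 C4 C3]]]] := H x Dx.
have xn0 : x != 0 by rewrite lt0r_neq0.
have yE := conic_root a20 b20 C2; have sE := conic_root b40 a40 C4.
set u := sc a1 x in C2 yE; set z := sc b1 x^-1 in C4 sE.
have uE : A * x ^+ 2 + B = x * u by rewrite sc_lin.
have zE : A' * x ^+ 2 + B' = x * z by rewrite sc_linV.
move: yE sE; rewrite -/q2 -/q4 -/p2 -/p4 -/k -/l.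
set y := _ / q2; set s := _ / q4 => yE sE.
have vE : k * v = q2 * y - p2 * u by rewrite /y; field; rewrite lt0r_neq0.
have wE : l * w = q4 * s - p4 * z by rewrite /s; field; rewrite lt0r_neq0.
clearbody y s u z.
exists (x * y), (x * s); rewrite !dsc_eval !exprMn yE sE uE zE; split; try ring.
have -> : e.[x ^+ 2] = x ^+ 2 * (k3 * k ^+ 2 * (q4 ^+ 2 * (z ^+ 2 + l) + p4 ^+ 2 * z ^+ 2)
  + 2 * p3 * k * l * p4 * p2 * (z * u)
  + l3 * l ^+ 2 * (q2 ^+ 2 * (u ^+ 2 + k) + p2 ^+ 2 * u ^+ 2) - q3 ^+ 2 * l ^+ 2 * k ^+ 2).
  have hu : A * x * x + B = x * u by rewrite -uE; ring.
  have hz : A' * x * x + B' = x * z by rewrite -zE; ring.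
  by rewrite /e /pu /pz !(lin_eval, hornerE) /= hu hz /k /l; ring.
rewrite -yE -sE.
rewrite !lin_eval.
have -> : (f1 * A' + f2 * A) * x ^+ 2 + (f1 * B' + f2 * B) =
  f1 * (A' * x ^+ 2 + B') + f2 * (A * x ^+ 2 + B) by ring.
have -> : (g1 * A' + g2 * A) * x ^+ 2 + (g1 * B' + g2 * B) =
  g1 * (A' * x ^+ 2 + B') + g2 * (A * x ^+ 2 + B) by ring.
rewrite uE zE.
transitivity (x ^+ 2 * (k3 * k ^+ 2 * (l * w) ^+ 2 +
  2 * p3 * k * l * ((k * v) * (l * w)) + l3 * l ^+ 2 * (k * v) ^+ 2
  - q3 ^+ 2 * l ^+ 2 * k ^+ 2)).
  by rewrite vE wE /f1 /f2 /g1 /g2 /h; ring.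
transitivity (x ^+ 2 * k ^+ 2 * l ^+ 2 * ((a3 ^+ 2 - 1) * v ^+ 2 +
  2 * (b3 * a3 + 1) * (v * w) + (b3 ^+ 2 - 1) * w ^+ 2 - (b3 + a3) ^+ 2)).
  by rewrite /k3 /l3 /p3 /q3; ring.
by rewrite C3 subrr mulr0.
Qed.

(** With slope 1 the first conic is linear in [v], which becomes rational with a pole at the zero of
    [u]. Only one square root is left; its coefficient in the third conic vanishes identically, yet
    at that pole the product [v * w] contributes a term that nothing compensates. *)
Lemma vertex_degenerate1 (R : realType) (D : set R)
    (a1 b1 b2 a3 b3 a4 b4 : R) :
  0 < a1 -> 0 < b1 -> 0 < b2 -> 0 < a3 -> 0 < b3 -> 0 < a4 -> 0 < b4 ->
  infinite_set D ->
  (forall x, D x -> 0 < x /\ exists v w,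
    [/\ conic 1 b2 (sc a1 x) v, conic b4 a4 (sc b1 x^-1) w & conic b3 a3 v w]) ->
  a1 != 1 -> b1 != b4 -> b4 ^+ 2 - 1 != 0 -> False.
Proof.
move=> a10 b10 b20 a30 b30 a40 b40 infD H a11 b14 l0.
have infD2 := infinite_sqr infD (fun x Dx => (H x Dx).1).
pose p2 := b2 + 1; pose l2 := b2 ^+ 2 - 1.
pose q4 := b4 + a4; pose p4 := b4 * a4 + 1; pose p3 := b3 * a3 + 1.
pose q3 := b3 + a3.
have q40 : 0 < q4 by rewrite addr_gt0.
have p20 : 0 < p2 by rewrite addr_gt0.
have p40 : 0 < p4 by rewrite addr_gt0 ?mulr_gt0.
have p30 : 0 < p3 by rewrite addr_gt0 ?mulr_gt0.
pose l := b4 ^+ 2 - 1.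
pose k3 := b3 ^+ 2 - 1; pose l3 := a3 ^+ 2 - 1.
pose A := (1 + a1) / 2; pose B := (1 - a1) / 2.
pose A' := (1 - b1) / 2; pose B' := (1 + b1) / 2.
have A0 : A != 0 by rewrite lt0r_neq0 // divr_gt0 // addr_gt0.
have B0 : B != 0 by rewrite mulf_neq0 ?invr_eq0 ?pnatr_eq0 // subr_eq0 eq_sym.
pose pu := lin A B; pose pz := lin A' B'.
pose n := p2 ^+ 2 *: 'X - l2 *: pu ^+ 2.
pose e := (l3 * l ^+ 2) *: n ^+ 2 - (4 * p2 * p3 * l * p4) *: (pu * pz * n)
  + (4 * p2 ^+ 2 * k3) *: (pu ^+ 2 *
      (q4 ^+ 2 *: (pz ^+ 2 + l *: 'X) + p4 ^+ 2 *: pz ^+ 2))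
  - (4 * p2 ^+ 2 * q3 ^+ 2 * l ^+ 2) *: (pu ^+ 2 * 'X).
pose m := (4 * p2 * p3 * l * q4) *: n - (8 * p2 ^+ 2 * k3 * q4 * p4) *: (pu * pz).
have neq : l + 4 * (A' * B') != 0.
  have -> : l + 4 * (A' * B') = b4 ^+ 2 - b1 ^+ 2 by rewrite /l /A' /B'; field.
  by rewrite subr_eq0 eqrXn2 // ?ltW // eq_sym.
have [_ pum] : e = 0 /\ pu * m = 0.
  apply: (quadratic_independent infD2 l0 neq) => _ [x Dx <-].
  have [x0 [v [w [C2 C4 C3]]]] := H x Dx.
  have xn0 : x != 0 by rewrite lt0r_neq0.
  have sE := conic_root b40 a40 C4.
  set u := sc a1 x in C2; set z := sc b1 x^-1 in C4 sE.
  have uE : A * x * x + B = x * u by rewrite sc_lin // expr2 mulrA.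
  have zE : A' * x * x + B' = x * z by rewrite sc_linV // expr2 mulrA.
  have uvE : 2 * p2 * (u * v) = p2 ^+ 2 - l2 * u ^+ 2.
    move: C2; rewrite /conic expr1n subrr mul0r addr0 mul1r /p2 /l2.
    by move=> C2; rewrite [b2 + 1]addrC -C2; ring.
  move: sE; rewrite -/q4 -/p4 -/l; set s := _ / q4 => sE.
  have wE : l * w = q4 * s - p4 * z by rewrite /s; field; rewrite lt0r_neq0.
  clearbody s u z; exists (x * s).
    rewrite exprMn sE dsc_eval.
    have -> : A' * x ^+ 2 + B' = x * z by rewrite -zE; ring.
    by rewrite /l; ring.
  have -> : e.[x ^+ 2] = x ^+ 4 * (l3 * l ^+ 2 * (2 * p2 * (u * v)) ^+ 2
    - 4 * p2 * p3 * l * p4 * (u * z * (2 * p2 * (u * v)))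
    + 4 * p2 ^+ 2 * k3 * (u ^+ 2 * (q4 ^+ 2 * s ^+ 2 + p4 ^+ 2 * z ^+ 2))
    - 4 * p2 ^+ 2 * q3 ^+ 2 * l ^+ 2 * u ^+ 2).
    rewrite uvE sE /e /n /pu /pz !(lin_eval, hornerE) /= uE zE /l; ring.
  have -> : (pu * m).[x ^+ 2] = x ^+ 3 * (4 * p2 * p3 * l * q4 * u * (2 * p2 * (u * v))
     - 8 * p2 ^+ 2 * k3 * q4 * p4 * u ^+ 2 * z).
    by rewrite uvE /m /n /pu /pz !(lin_eval, hornerE) /= uE zE; ring.
  transitivity (4 * p2 ^+ 2 * u ^+ 2 * x ^+ 4 * (l3 * l ^+ 2 * v ^+ 2 +
    2 * p3 * l * v * (l * w) + k3 * (l * w) ^+ 2 - q3 ^+ 2 * l ^+ 2)).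
    by rewrite wE; ring.
  transitivity (4 * p2 ^+ 2 * u ^+ 2 * x ^+ 4 * l ^+ 2 * ((a3 ^+ 2 - 1) * v ^+ 2 +
    2 * (b3 * a3 + 1) * (v * w) + (b3 ^+ 2 - 1) * w ^+ 2 - (b3 + a3) ^+ 2)).
    by rewrite /k3 /l3 /p3 /q3; ring.
  by rewrite C3 subrr mulr0.
have pu0 : pu != 0.
  apply/negP => /eqP /(congr1 (fun p => p.[0])).
  by rewrite /= lin_eval mulr0 add0r horner0; apply/eqP.
move/eqP: pum; rewrite mulf_eq0 (negbTE pu0) /= => /eqP.
(* The point [t0] may be negative, hence not the square of a time; only polynomial identities are
   evaluated there. It is not 0 because [a1 != 1]. *)
have [t0 t00 ut0] : exists2 t0, t0 != 0 & A * t0 + B = 0.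
  exists (- B / A); first by rewrite mulf_neq0 ?oppr_eq0 ?invr_eq0.
  by rewrite mulrC divfK // addNr.
move=> /(congr1 (fun p => p.[t0])); rewrite /m /n !(lin_eval, hornerE) /= ut0.
rewrite !(mul0r, mulr0, subr0) => /eqP.
rewrite !mulf_eq0 (negbTE t00) (negbTE l0).
by rewrite !pnatr_eq0 !(gt_eqF p20) (gt_eqF p30) (gt_eqF q40).
Qed.

(** Both unknown scales are now rational, with distinct poles [t0] and [t1]. The double poles of
    [v ^+ 2] and [w ^+ 2] in the third conic force [l3] and [k3] to vanish. What remains says that
    [v * w] is constant, so each pole is compensated by a zero of the other numerator. *)
Lemma vertex_degenerate2 (R : realType) (D : set R) (a1 b1 b2 a3 b3 a4 : R) :
  0 < a1 -> 0 < b1 -> 0 < b2 -> 0 < a3 -> 0 < b3 -> 0 < a4 ->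
  infinite_set D ->
  (forall x, D x -> 0 < x /\ exists v w,
    [/\ conic 1 b2 (sc a1 x) v, conic 1 a4 (sc b1 x^-1) w & conic b3 a3 v w]) ->
  a1 != 1 -> b1 != 1 -> False.
Proof.
move=> a10 b10 b20 a30 b30 a40 infD H a11 b11.
have infD2 := infinite_sqr infD (fun x Dx => (H x Dx).1).
pose p2 := b2 + 1; pose l2 := b2 ^+ 2 - 1.
pose p4 := a4 + 1; pose k4 := a4 ^+ 2 - 1.
pose p3 := b3 * a3 + 1; pose q3 := b3 + a3.
have p20 : 0 < p2 by rewrite addr_gt0.
have p40 : 0 < p4 by rewrite addr_gt0 ?mulr_gt0.
have p30 : 0 < p3 by rewrite addr_gt0 ?mulr_gt0.
pose k3 := b3 ^+ 2 - 1; pose l3 := a3 ^+ 2 - 1.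
pose A := (1 + a1) / 2; pose B := (1 - a1) / 2.
pose A' := (1 - b1) / 2; pose B' := (1 + b1) / 2.
have A0 : A != 0 by rewrite lt0r_neq0 // divr_gt0 // addr_gt0.
have B'0 : B' != 0 by rewrite lt0r_neq0 // divr_gt0 // addr_gt0.
have B0 : B != 0 by rewrite mulf_neq0 ?invr_eq0 ?pnatr_eq0 // subr_eq0 eq_sym.
have A'0 : A' != 0 by rewrite mulf_neq0 ?invr_eq0 ?pnatr_eq0 // subr_eq0 eq_sym.
have det : A * B' - B * A' != 0.
  have -> : A * B' - B * A' = (a1 + b1) / 2 by rewrite /A /B /A' /B'; field.
  by rewrite mulf_neq0 ?invr_eq0 ?pnatr_eq0 // lt0r_neq0 // addr_gt0.
pose t0 := - B / A; pose t1 := - B' / A'.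
have t00 : t0 != 0 by rewrite mulf_neq0 ?oppr_eq0 ?invr_eq0.
have t10 : t1 != 0 by rewrite mulf_neq0 ?oppr_eq0 ?invr_eq0.
have ut0 : A * t0 + B = 0 by rewrite /t0; field.
have zt1 : A' * t1 + B' = 0 by rewrite /t1; field.
have zt0 : A' * t0 + B' != 0.
  have -> : A' * t0 + B' = (A * B' - B * A') / A by rewrite /t0; field.
  by rewrite mulf_neq0 ?invr_eq0.
have ut1 : A * t1 + B != 0.
  have -> : A * t1 + B = - (A * B' - B * A') / A' by rewrite /t1; field.
  by rewrite mulf_neq0 ?oppr_eq0 ?invr_eq0.
pose pu := lin A B; pose pz := lin A' B'.
pose n := p2 ^+ 2 *: 'X - l2 *: pu ^+ 2.
pose m := p4 ^+ 2 *: 'X - k4 *: pz ^+ 2.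
have nE t : n.[t] = p2 ^+ 2 * t - l2 * (A * t + B) ^+ 2.
  by rewrite /n !(lin_eval, hornerE) /=; ring.
have mE t : m.[t] = p4 ^+ 2 * t - k4 * (A' * t + B') ^+ 2.
  by rewrite /m !(lin_eval, hornerE) /=; ring.
pose F := (l3 * p4 ^+ 2) *: (pz * n) ^+ 2 + (2 * p3 * p2 * p4) *: (pu * pz * n * m)
  + (k3 * p2 ^+ 2) *: (pu * m) ^+ 2 - (4 * p2 ^+ 2 * p4 ^+ 2 * q3 ^+ 2) *:
    ((pu * pz) ^+ 2 * 'X).
have FE t : F.[t] = l3 * p4 ^+ 2 * ((A' * t + B') * n.[t]) ^+ 2
  + 2 * p3 * p2 * p4 * ((A * t + B) * (A' * t + B') * n.[t] * m.[t])
  + k3 * p2 ^+ 2 * ((A * t + B) * m.[t]) ^+ 2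
  - 4 * p2 ^+ 2 * p4 ^+ 2 * q3 ^+ 2 * (((A * t + B) * (A' * t + B')) ^+ 2 * t).
  rewrite /F /pu /pz; move: (n) (m) => n' m'.
  by rewrite !(lin_eval, hornerE) /=; ring.
have F0 : F = 0.
  apply: (poly_infinite_roots infD2) => _ [x Dx <-].
  have [x0 [v [w [C2 C4 C3]]]] := H x Dx.
  have xn0 : x != 0 by rewrite lt0r_neq0.
  set u := sc a1 x in C2; set z := sc b1 x^-1 in C4.
  have uE : A * x ^+ 2 + B = x * u by rewrite sc_lin.
  have zE : A' * x ^+ 2 + B' = x * z by rewrite sc_linV.
  have uvE : n.[x ^+ 2] = x ^+ 2 * (2 * p2 * (u * v)).
    rewrite nE uE; move: C2; rewrite /conic expr1n subrr mul0r addr0 mul1r /p2 /l2.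
    by rewrite [b2 + 1]addrC => C2; rewrite -C2; ring.
  have zwE : m.[x ^+ 2] = x ^+ 2 * (2 * p4 * (z * w)).
    rewrite mE zE; move: C4; rewrite /conic expr1n subrr mul0r addr0 mul1r /p4 /k4.
    by rewrite [a4 + 1]addrC => C4; rewrite -C4; ring.
  rewrite FE uvE zwE uE zE.
  transitivity (4 * p2 ^+ 2 * p4 ^+ 2 * u ^+ 2 * z ^+ 2 * x ^+ 6 *
    ((a3 ^+ 2 - 1) * v ^+ 2 + 2 * (b3 * a3 + 1) * (v * w) +
     (b3 ^+ 2 - 1) * w ^+ 2 - (b3 + a3) ^+ 2)).
    by rewrite /k3 /l3 /p3 /q3; ring.
  by rewrite C3 subrr mulr0.
have p2n : p2 != 0 by rewrite lt0r_neq0.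
have p4n : p4 != 0 by rewrite lt0r_neq0.
have p3n : p3 != 0 by rewrite lt0r_neq0.
have nt0 : n.[t0] != 0 by rewrite nE ut0 expr0n mulr0 subr0 mulf_neq0 ?expf_neq0.
have mt1 : m.[t1] != 0 by rewrite mE zt1 expr0n mulr0 subr0 mulf_neq0 ?expf_neq0.
have l30 : l3 = 0.
  have := FE t0; rewrite F0 horner0 ut0 !(mul0r, mulr0, expr0n) /= ?mulr0 ?subr0 ?addr0.
  move=> /esym/eqP; rewrite !mulf_eq0.
  by rewrite (negbTE zt0) (negbTE nt0) (negbTE p4n) !orbF => /eqP.
have k30 : k3 = 0.
  have := FE t1; rewrite F0 horner0 zt1 !(mul0r, mulr0, expr0n) /= ?mulr0 ?subr0 ?add0r.
  move=> /esym/eqP; rewrite !mulf_eq0.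
  by rewrite (negbTE ut1) (negbTE mt1) (negbTE p2n) !orbF => /eqP.
pose G := (2 * p3 * p2 * p4) *: (n * m)
  - (4 * p2 ^+ 2 * p4 ^+ 2 * q3 ^+ 2) *: (pu * pz * 'X).
have G0 : G = 0.
  have : pu * pz * G = 0.
    rewrite -F0 /F /G l30 k30 !mul0r !scale0r add0r addr0.
    by rewrite mulrBr -!scalerAr; congr (_ *: _ - _ *: _); ring.
  move=> /eqP; rewrite !mulf_eq0 => /orP[/orP[]|/eqP//] /eqP.
    move=> /(congr1 (fun p => p.[t1])); rewrite /= lin_eval horner0 => /eqP.
    by rewrite (negbTE ut1).
  move=> /(congr1 (fun p => p.[t0])); rewrite /= lin_eval horner0 => /eqP.
  by rewrite (negbTE zt0).
have GE t : 2 * p3 * p2 * p4 * (n.[t] * m.[t]) =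
    4 * p2 ^+ 2 * p4 ^+ 2 * q3 ^+ 2 * ((A * t + B) * (A' * t + B') * t).
  apply/eqP; rewrite -subr_eq0 -(horner0 t) -G0 /G /pu /pz; move: (n) (m) => n' m'.
  by rewrite !(lin_eval, hornerE) /=; apply/eqP; ring.
have cn : 2 * p3 * p2 * p4 != 0 by rewrite !mulf_neq0 ?pnatr_eq0.
have mt0 : m.[t0] = 0.
  have := GE t0; rewrite ut0 !(mul0r, mulr0) => /eqP.
  by rewrite mulf_eq0 (negbTE cn) mulf_eq0 (negbTE nt0) => /eqP.
have nt1 : n.[t1] = 0.
  have := GE t1; rewrite zt1 !(mul0r, mulr0) => /eqP.
  by rewrite mulf_eq0 (negbTE cn) mulf_eq0 (negbTE mt1) orbF => /eqP.
(* At 0 one of [l2] and [k4] has to vanish. Then [n] or [m] is a multiple of ['X], contrary to its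
   zero at [t1] or [t0]. *)
have := GE 0; rewrite !mulr0 => /eqP; rewrite mulf_eq0 (negbTE cn) /=.
clear FE F0 GE G0 H; clearbody A B A' B'.
rewrite nE mE !mulr0 !add0r mulrNN !mulf_eq0.
rewrite (negbTE B0) (negbTE B'0) !orbF => /orP[] /eqP c0.
  move: nt1; rewrite nE c0 mul0r subr0 => /eqP.
  by apply/negP; rewrite mulf_neq0 ?expf_neq0.
move: mt0; rewrite mE c0 mul0r subr0 => /eqP.
by apply/negP; rewrite mulf_neq0 ?expf_neq0.
Qed.

Lemma vertex_rigid (R : realType) (D : set R) (a1 b1 a2 b2 a3 b3 a4 b4 : R) :
  0 < a1 -> 0 < b1 -> 0 < a2 -> 0 < b2 -> 0 < a3 -> 0 < b3 -> 0 < a4 -> 0 < b4 ->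
  infinite_set D ->
  (forall x, D x -> 0 < x /\ exists v w,
    [/\ conic a2 b2 (sc a1 x) v, conic b4 a4 (sc b1 x^-1) w & conic b3 a3 v w]) ->
  a1 = a2 \/ b1 = b4.
Proof.
move=> a10 b10 a20 b20 a30 b30 a40 b40 infD H.
have [->|a12] := eqVneq a1 a2; first by left.
have [->|b14] := eqVneq b1 b4; first by right.
exfalso; have sq1 (c : R) : 0 < c -> (c ^+ 2 - 1 == 0) = (c == 1).
  by move=> c0; rewrite subr_eq0 sqrf_eq1 (gt_eqF (lt_trans (ltrN10 R) c0)) orbF.
have [k0|k0] := eqVneq (a2 ^+ 2 - 1) 0; have [l0|l0] := eqVneq (b4 ^+ 2 - 1) 0.
- move/eqP: k0; rewrite sq1 // => /eqP k0; move/eqP: l0; rewrite sq1 // => /eqP l0.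
  by subst; apply: vertex_degenerate2 infD H a12 b14.
- move/eqP: k0; rewrite sq1 // => /eqP k0.
  by subst; apply: vertex_degenerate1 infD H a12 b14 l0.
- move/eqP: l0; rewrite sq1 // => /eqP l0; subst.
  (* The two edges of the first face exchange roles, which inverts its time. *)
  have infDV : infinite_set [set x^-1 | x in D].
    by apply: infinite_image infD => x y _ _; apply: invr_inj.
  apply: (@vertex_degenerate1 R _ b1 a1 a4 b3 a3 b2 a2) infDV _ b14 a12 k0 => //.
  move=> _ [x Dx <-]; have [x0 [v [w [C2 C4 C3]]]] := H x Dx.
  split; first by rewrite invr_gt0.
  by exists w, v; split => //; [rewrite invrK | apply: conic_sym].
- exact: vertex_generic infD H a12 b14 k0 l0.
Qed.

(** * Classification of the compatible families of times *)

(** Equal scales mean [X = Y] or [(1 + c) * (X * Y) = 1 - c]. For [c < 1] the bound [1 - c / 2],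
    whose square exceeds [1 - c], keeps [X * Y] above [1 - c] and excludes the second case; being
    less than 1, it still leaves a neighbourhood of 1. *)
Lemma sc_inj (R : realType) (c X Y : R) : 0 < c -> 0 < X -> 0 < Y ->
  1 - c / 2 < X -> 1 - c / 2 < Y -> sc c X = sc c Y -> X = Y.
Proof.
move=> c0 X0 Y0 X1 Y1 E.
have XY0 : 0 < X * Y by rewrite mulr_gt0.
have XY : 1 - c < X * Y.
  have [c1|c1] := ltP c 1; last by rewrite (le_lt_trans _ XY0) // subr_le0.
  have c2 : 0 < 1 - c / 2 by lra.
  have : (1 - c / 2) * (1 - c / 2) < X * Y by apply: ltr_pM => //; exact: ltW.
  by have : 0 <= c * c; [rewrite mulr_ge0 // ltW | lra].
have E0 : (X - Y) * (X * Y - (1 - c) + c * (X * Y)) = 0.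
  transitivity (2 * X * Y * (sc c X - sc c Y)); last by rewrite E subrr mulr0.
  by rewrite /sc; field; rewrite !lt0r_neq0.
move/eqP: E0; rewrite mulf_eq0 subr_eq0 => /orP[/eqP //|].
by rewrite gt_eqF // addr_gt0 ?subr_gt0 // mulr_gt0.
Qed.

Lemma sc_slope (R : realType) (c c' X : R) : 0 < X -> X != 1 ->
  sc c X = sc c' X -> c = c'.
Proof.
move=> X0 X1 E.
have E0 : (c - c') * ((X - 1) * (X + 1)) = 0.
  transitivity (2 * X * (sc c X - sc c' X)); last by rewrite E subrr mulr0.
  by rewrite /sc; field; rewrite lt0r_neq0.
move/eqP: E0; rewrite !mulf_eq0 !subr_eq0 (negbTE X1) (gt_eqF (addr_gt0 X0 _)) //.
by rewrite !orbF => /eqP.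
Qed.

(** Write [X] and [Y] as exponentials of [t] and [t']. If [c1 != c2], subtracting the two equations
    makes [sh t'] a multiple [k] of [sh t], and then [ch t'] is [ch t + e sh t]. The relation
    [ch ^ 2 - sh ^ 2 = 1] for infinitely many [t] forces [e = 0] and [k = 1], hence [c1 = a1]. *)
Lemma sc_pair (R : realType) (D : set R) (c1 a1 c2 a2 : R) :
  0 < c1 -> 0 < a1 -> infinite_set D ->
  (forall X, D X -> 0 < X /\ exists Y,
     [/\ 0 < Y, sc c1 X = sc a1 Y & sc c2 X = sc a2 Y]) ->
  c1 != a1 -> c1 = c2.
Proof.
move=> c10 a10 infD H ca; apply/eqP; apply/negP => /negP c12.
have infD2 := infinite_sqr infD (fun x Dx => (H x Dx).1).
have main (X Y : R) : 0 < X -> 0 < Y -> sc c1 X = sc a1 Y -> sc c2 X = sc a2 Y ->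
    (c1 - c2) * (X - X^-1) = (a1 - a2) * (Y - Y^-1) /\
    X + X^-1 + c1 * (X - X^-1) = Y + Y^-1 + a1 * (Y - Y^-1).
  move=> X0 Y0; rewrite /sc => E1 E2; have X0' := lt0r_neq0 X0.
  have Y0' := lt0r_neq0 Y0.
  split; lra.
have [aa|a12] := eqVneq a1 a2.
  have l0 : lin 1 (-1) = 0 :> {poly R}.
    apply: (poly_infinite_roots infD2) => _ [X DX <-].
    have [X0 [Y [Y0 E1 E2]]] := H X DX; have [+ _] := main X Y X0 Y0 E1 E2.
    rewrite aa subrr mul0r => /eqP; rewrite mulf_eq0 subr_eq0 (negbTE c12) /=.
    rewrite subr_eq0 lin_eval => /eqP h; rewrite mul1r expr2 {2}h.
    by rewrite divff ?subrr // lt0r_neq0.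
  have := congr1 (fun p => p.[0]) l0; rewrite /= lin_eval horner0 mulr0 add0r.
  by move/eqP; rewrite oppr_eq0 oner_eq0.
have a12' : a1 - a2 != 0 by rewrite subr_eq0.
pose k := (c1 - c2) / (a1 - a2); pose e := c1 - a1 * k.
pose f := e ^+ 2 - k ^+ 2 + 1.
have l0 : lin 1 (-1) * lin (2 * e + f) (2 * e - f) = 0.
  apply: (poly_infinite_roots infD2) => _ [X DX <-].
  have [X0 [Y [Y0 E1 E2]]] := H X DX; have [h1 h2] := main X Y X0 Y0 E1 E2.
  have Xn := lt0r_neq0 X0; have Yn := lt0r_neq0 Y0.
  have h1' : Y - Y^-1 = k * (X - X^-1).
    by rewrite /k mulrAC h1 mulrAC divff // mul1r.
  have h2' : Y + Y^-1 = X + X^-1 + e * (X - X^-1).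
    by rewrite h1' in h2; rewrite /e; lra.
  have h3 : (Y + Y^-1) ^+ 2 - (Y - Y^-1) ^+ 2 = 4 by field.
  have h4 : (X + X^-1) ^+ 2 - (X - X^-1) ^+ 2 = 4 by field.
  rewrite hornerM !lin_eval.
  transitivity (X ^+ 2 * (((Y + Y^-1) ^+ 2 - (Y - Y^-1) ^+ 2) -
     ((X + X^-1) ^+ 2 - (X - X^-1) ^+ 2))); last by rewrite h3 h4 subrr mulr0.
  by rewrite h1' h2' /f; field.
have l2 : lin (2 * e + f) (2 * e - f) = 0.
  move/eqP: l0; rewrite mulf_eq0 => /orP[|/eqP //] /eqP /(congr1 (fun p => p.[0])).
  rewrite /= lin_eval horner0 mulr0 add0r => /eqP.
  by rewrite oppr_eq0 oner_eq0.
have := congr1 (fun p => p.[0]) l2; have := congr1 (fun p => p.[1]) l2.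
rewrite /= !lin_eval !horner0 => g1 g2.
have e0 : e = 0 by lra.
have f0 : f = 0 by lra.
have k2 : k ^+ 2 = 1 by move: f0; rewrite /f e0; lra.
have ca1 : c1 = a1 * k by move: e0; rewrite /e; lra.
have k0 : 0 < k by move: c10; rewrite ca1 pmulr_rgt0.
have k1 : k = 1 by apply/eqP; rewrite -(@eqrXn2 _ 2) ?ltW // k2 expr1n.
by move: ca; rewrite ca1 k1 mulr1 eqxx.
Qed.

Lemma vertex_rigid_family (R : realType) (D : set R) (X1 X2 X3 X4 : R -> R)
    (a1 b1 a2 b2 a3 b3 a4 b4 : R) :
  0 < a1 -> 0 < b1 -> 0 < a2 -> 0 < b2 -> 0 < a3 -> 0 < b3 -> 0 < a4 -> 0 < b4 ->
  infinite_set D -> {in D &, injective X1} ->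
  (forall t, D t -> [/\ 0 < X1 t, 0 < X2 t, 0 < X3 t & 0 < X4 t]) ->
  (forall t, D t ->
    [/\ sc a1 (X1 t) = sc a2 (X2 t), sc b2 (X2 t)^-1 = sc b3 (X3 t)^-1,
        sc a3 (X3 t) = sc a4 (X4 t) & sc b4 (X4 t)^-1 = sc b1 (X1 t)^-1]) ->
  a1 = a2 \/ b1 = b4.
Proof.
move=> a10 b10 a20 b20 a30 b30 a40 b40 infD X1i X0 H.
apply: (vertex_rigid a10 b10 a20 b20 a30 b30 a40 b40 (infinite_image X1i infD)).
move=> _ [t Dt <-]; have [x1 x2 x3 x4] := X0 t Dt; split => //.
have [E12 E23 E34 E41] := H t Dt.
exists (sc b2 (X2 t)^-1), (sc a4 (X4 t)); split.
- by rewrite E12; apply: sc_conic; rewrite lt0r_neq0.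
- by rewrite -E41; apply/conic_sym/sc_conic; rewrite lt0r_neq0.
- by rewrite E23 -E34; apply/conic_sym/sc_conic; rewrite lt0r_neq0.
Qed.

Section Combinatorics.
Variable R : realType.
Implicit Types (m n : nat) (a b : nat -> nat -> R) (D : set R).

(* [a i j] and [b i j] are the parameters of the face of index [(i, j)], with
   bottom side of slope [a i j] and right side of slope [- b i j]; [- b] appears
   as [b] at the reversed time [X^-1]. *)
Definition compatible m n a b (X : nat -> nat -> R) : Prop :=
  (forall i j, (i < m)%N -> (j.+1 < n)%N ->
     sc (a i j)^-1 (X i j) = sc (a i j.+1) (X i j.+1)) /\
  (forall i j, (i.+1 < m)%N -> (j < n)%N ->
     sc (b i j) (X i j)^-1 = sc (b i.+1 j)^-1 (X i.+1 j)^-1).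

(** What is kept of a deformation once the geometry is forgotten. [flex_inj] says that the time of a
    single face determines the parameter; [flex_U] and [flex_V] record the injectivity of [sc] near
    1, which does not follow from positivity of the times. *)
Record flexible m n a b D (X : R -> nat -> nat -> R) : Prop := Flexible {
  flex_a : forall i j, (i < m)%N -> (j < n)%N -> 0 < a i j;
  flex_b : forall i j, (i < m)%N -> (j < n)%N -> 0 < b i j;
  flex_D : infinite_set D;
  flex_X : forall t i j, D t -> (i < m)%N -> (j < n)%N -> 0 < X t i j;
  flex_inj : forall i j, (i < m)%N -> (j < n)%N ->
    {in D &, injective (fun t => X t i j)};
  flex_compat : forall t, D t -> compatible m n a b (X t);
  flex_U : forall t i j, D t -> (i < m)%N -> (j.+1 < n)%N ->
    (a i j)^-1 = a i j.+1 -> X t i j = X t i j.+1;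
  flex_V : forall t i j, D t -> (i.+1 < m)%N -> (j < n)%N ->
    b i j = (b i.+1 j)^-1 -> X t i j = X t i.+1 j }.

(** Transposing the net reads each face [ABCD] as [ADCB]: the parameters become [b^-1] and [a^-1],
    and time is inverted. *)
Lemma flexible_tr m n a b D X : flexible m n a b D X ->
  flexible n m (fun i j => (b j i)^-1) (fun i j => (a j i)^-1) D
    (fun t i j => (X t j i)^-1).
Proof.
case=> a0 b0 infD X0 Xi Xc XU XV; split => //.
- by move=> i j *; rewrite invr_gt0 b0.
- by move=> i j *; rewrite invr_gt0 a0.
- by move=> t i j *; rewrite invr_gt0 X0.
- by move=> i j hi hj s t Ds Dt /invr_inj; apply: Xi.
- move=> t Dt; have [cU cV] := Xc t Dt; split => i j hi hj.
    by rewrite invrK cV.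
  by rewrite !invrK cU.
- by move=> t i j Dt hi hj; rewrite invrK => E; rewrite (XV t j i).
- move=> t i j Dt hi hj E; rewrite (XU t j i) //.
  by rewrite E invrK.
Qed.

Lemma flexible_neq1 m n a b D X i j : flexible m n a b D X ->
  (i < m)%N -> (j < n)%N -> exists2 t, D t & X t i j != 1.
Proof.
move=> F hi hj; apply: contrapT => H.
apply: (infinite_image (flex_inj F hi hj) (flex_D F)).
apply: (@sub_finite_set _ _ [set 1]); last exact: finite_set1.
move=> _ [t Dt <-] /=; apply/eqP/negPn/negP => X1.
by apply: H; exists t.
Qed.

(** Rigidity is applied at one vertex from each of its four faces. If only one of two opposite edges
    had equal slopes, both transverse edges would have equal slopes; the four times would then
    coincide, and so would the slopes on the other edge. *)
Lemma flexible_step m n a b D X i j : flexible m n a b D X ->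
  (i.+1 < m)%N -> (j.+1 < n)%N ->
  ((a i j)^-1 = a i j.+1 <-> (a i.+1 j)^-1 = a i.+1 j.+1) /\
  ((a i j)^-1 != a i j.+1 -> b i j = (b i.+1 j)^-1 /\ b i j.+1 = (b i.+1 j.+1)^-1).
Proof.
move=> F hi hj; have hi' := ltnW hi; have hj' := ltnW hj.
have [a0 b0 infD X0 Xi Xc XU XV] := F.
have cU t Dt := (Xc t Dt).1; have cV t Dt := (Xc t Dt).2.
have V00 : (a i j)^-1 = a i j.+1 \/ b i j = (b i.+1 j)^-1.
  apply: (@vertex_rigid_family R D (fun t => X t i j) (fun t => X t i j.+1)
    (fun t => X t i.+1 j.+1) (fun t => X t i.+1 j) _ _ _ (b i j.+1)
    (a i.+1 j.+1) (b i.+1 j.+1)^-1 (a i.+1 j)^-1);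
    rewrite ?invr_gt0 ?a0 ?b0 //; first exact: Xi.
    by move=> t Dt; rewrite !X0.
  by move=> t Dt; rewrite cU // cV // cU // cV.
have V10 : (a i.+1 j)^-1 = a i.+1 j.+1 \/ (b i.+1 j)^-1 = b i j.
  apply: (@vertex_rigid_family R D (fun t => X t i.+1 j) (fun t => X t i.+1 j.+1)
    (fun t => X t i j.+1) (fun t => X t i j) _ _ _ (b i.+1 j.+1)^-1
    (a i j.+1) (b i j.+1) (a i j)^-1);
    rewrite ?invr_gt0 ?a0 ?b0 //; first exact: Xi.
    by move=> t Dt; rewrite !X0.
  by move=> t Dt; rewrite !cU // !cV.
have V01 : a i j.+1 = (a i j)^-1 \/ b i j.+1 = (b i.+1 j.+1)^-1.
  apply: (@vertex_rigid_family R D (fun t => X t i j.+1) (fun t => X t i j)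
    (fun t => X t i.+1 j) (fun t => X t i.+1 j.+1) _ _ _ (b i j)
    (a i.+1 j)^-1 (b i.+1 j)^-1 (a i.+1 j.+1));
    rewrite ?invr_gt0 ?a0 ?b0 //; first exact: Xi.
    by move=> t Dt; rewrite !X0.
  by move=> t Dt; rewrite !cU // !cV.
have V11 : a i.+1 j.+1 = (a i.+1 j)^-1 \/ (b i.+1 j.+1)^-1 = b i j.+1.
  apply: (@vertex_rigid_family R D (fun t => X t i.+1 j.+1) (fun t => X t i.+1 j)
    (fun t => X t i j) (fun t => X t i j.+1) _ _ _ (b i.+1 j)^-1
    (a i j)^-1 (b i j) (a i j.+1));
    rewrite ?invr_gt0 ?a0 ?b0 //; first exact: Xi.
    by move=> t Dt; rewrite !X0.
  by move=> t Dt; rewrite !cU // !cV.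
split; last first.
  by move=> /eqP nU; split; [case: V00 | case: V01 => // /esym].
(* All scales equal 1 at time 1, so slopes can be read off only at another time. *)
have [t Dt Xt] := flexible_neq1 F hi' hj'.
have [s Ds Xs] := flexible_neq1 F hi hj'.
split=> E; apply: contrapT => nE.
  have eV : b i j = (b i.+1 j)^-1 by case: V10.
  have eV' : b i j.+1 = (b i.+1 j.+1)^-1 by case: V11 => // /esym.
  apply: nE; apply: (sc_slope (X0 t i.+1 j Dt hi hj')).
    by rewrite -(XV t i j).
  by rewrite cU // -(XV t i j.+1) // -(XU t i j) // (XV t i j).
have eV : b i j = (b i.+1 j)^-1 by case: V00.
have eV' : b i j.+1 = (b i.+1 j.+1)^-1 by case: V01 => // /esym.
apply: nE; apply: (sc_slope (X0 s i j Ds hi' hj')).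
  by rewrite (XV s i j).
by rewrite cU // (XV s i j.+1) // -(XU s i.+1 j) // -(XV s i j).
Qed.

Lemma iff_const m (Q : nat -> Prop) i0 : (i0 < m)%N ->
  (forall i, (i.+1 < m)%N -> Q i <-> Q i.+1) -> Q i0 ->
  forall i, (i < m)%N -> Q i.
Proof.
move=> hi0 QQ Qi0.
have Q0 : Q 0.
  elim: i0 hi0 Qi0 => // i IH hi /(QQ _ hi); apply: IH; exact: ltnW.
elim=> // i IH hi; apply/(QQ _ hi); apply: IH; exact: ltnW.
Qed.

(** The exceptional edge spreads to all [i] at [j0], which makes the transverse edges there regular;
    by the transposed step this spreads to all [j]. Hence the times do not depend on [i]. At [j0],
    where slopes differ, [sc_pair] then gives the equality for [a], and the common scales carry it
    to the other [j]. *)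
Lemma flexible_21 m n a b D X i0 j0 : flexible m n a b D X ->
  (i0 < m)%N -> (j0.+1 < n)%N -> (a i0 j0)^-1 != a i0 j0.+1 ->
  forall i j, (i.+1 < m)%N -> (j < n)%N ->
    b i j = (b i.+1 j)^-1 /\ a i j = a i.+1 j.
Proof.
move=> F hi0 hj0 nU.
have Ftr := flexible_tr F.
have nUi : forall i, (i < m)%N -> (a i j0)^-1 != a i j0.+1.
  apply: (iff_const hi0 _ nU) => i hi.
  have [E _] := flexible_step F hi hj0.
  by split=> /eqP h; apply/eqP => /E.
have V i j : (i.+1 < m)%N -> (j < n)%N -> b i j = (b i.+1 j)^-1.
  move=> hi; move: j.
  apply: (@iff_const n _ j0 (ltnW hj0)).
    move=> j hj; have [+ _] := flexible_step Ftr hj hi.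
    by rewrite !invrK.
  have [_ H] := flexible_step F hi hj0.
  by have [] := H (nUi i (ltnW hi)).
have XV t i j : D t -> (i.+1 < m)%N -> (j < n)%N -> X t i j = X t i.+1 j.
  by move=> Dt hi hj; apply: (flex_V F) => //; apply: V.
have [a0 b0 infD X0 Xi Xc _ _] := F.
have cU t Dt := (Xc t Dt).1.
move=> i j hi hj; split; first exact: V.
move: j hj; have hi' := ltnW hi; apply: (@iff_const n _ j0 (ltnW hj0)).
  move=> j hj; have hj' := ltnW hj.
  have [t Dt Xt] := flexible_neq1 F hi' hj'.
  have [s Ds Xs] := flexible_neq1 F hi' hj.
  split=> E.
    apply: (sc_slope (X0 s i j.+1 Ds hi' hj) Xs).
    by rewrite -cU // (XV s i j.+1) // -cU // E (XV s i j).
  apply: invr_inj; apply: (sc_slope (X0 t i j Dt hi' hj') Xt).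
  by rewrite cU // (XV t i j) // cU // E (XV t i j.+1).
have hj0' := ltnW hj0.
apply: invr_inj; apply: (@sc_pair R [set X t i j0 | t in D] _ (a i j0.+1) _ (a i.+1 j0.+1)).
- by rewrite invr_gt0 a0.
- by rewrite a0.
- exact: infinite_image (Xi _ _ _ _) infD.
- move=> _ [t Dt <-]; split; first exact: X0.
  exists (X t i j0.+1); split; first exact: X0.
    exact: cU.
  by rewrite XV // cU // -XV.
- exact: nUi.
Qed.

Lemma flexible_classification m n a b D X : flexible m n a b D X ->
  [\/ forall i j, (i < m)%N -> (j.+1 < n)%N ->
        (a i j)^-1 = a i j.+1 /\ b i j = b i j.+1,
      forall i j, (i.+1 < m)%N -> (j < n)%N ->
        b i j = (b i.+1 j)^-1 /\ a i j = a i.+1 j |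
      (forall i j, (i < m)%N -> (j.+1 < n)%N -> (a i j)^-1 = a i j.+1) /\
      (forall i j, (i.+1 < m)%N -> (j < n)%N -> b i j = (b i.+1 j)^-1)].
Proof.
move=> F.
have [allU|/existsNP[i0 /existsNP[j0 /not_implyP[hi0 /not_implyP[hj0 /eqP nU]]]]] :=
  pselect (forall i j, (i < m)%N -> (j.+1 < n)%N -> (a i j)^-1 = a i j.+1);
  last by constructor 2; apply: flexible_21 F hi0 hj0 nU.
have [allV|/existsNP[i0 /existsNP[j0 /not_implyP[hi0 /not_implyP[hj0 /eqP nV]]]]] :=
  pselect (forall i j, (i.+1 < m)%N -> (j < n)%N -> b i j = (b i.+1 j)^-1);
  first by constructor 3.
constructor 1 => i j hi hj.
have [|E E'] := flexible_21 (flexible_tr F) hj0 hi0 _ hj hi; first by rewrite invrK.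
by rewrite {1}E invrK; split => //; apply: invr_inj.
Qed.

End Combinatorics.

(** * Existence of compatible families *)

Lemma near_all_ltn (T : Type) (F : set_system T) {FF : Filter F} m
    (Q : nat -> T -> Prop) :
  (forall i, (i < m)%N -> \forall t \near F, Q i t) ->
  \forall t \near F, forall i, (i < m)%N -> Q i t.
Proof.
elim: m => [|m IH] H; first by apply: filterE.
have H1 : \forall t \near F, forall i, (i < m)%N -> Q i t.
  by apply: IH => i hi; apply: H; apply: ltnW.
apply: filterS2 H1 (H m (ltnSn m)) => t h1 h2 i; rewrite ltnS leq_eqVlt.
by move=> /orP[/eqP ->|/h1].
Qed.

Lemma near_all_ltn2 (T : Type) (F : set_system T) {FF : Filter F} m n
    (Q : nat -> nat -> T -> Prop) :
  (forall i j, (i < m)%N -> (j < n)%N -> \forall t \near F, Q i j t) ->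
  \forall t \near F, forall i j, (i < m)%N -> (j < n)%N -> Q i j t.
Proof.
move=> H; have : \forall t \near F, forall i, (i < m)%N ->
    forall j, (j < n)%N -> Q i j t.
  by apply: near_all_ltn => i hi; apply: near_all_ltn => j hj; apply: H.
by apply: filterS => t h i j hi hj; apply: h.
Qed.

Section Family.
Variable R : realType.

Lemma sc1 (c : R) : sc c 1 = 1.
Proof. by rewrite /sc; field. Qed.

Lemma continuous_invr (f : R -> R) (t : R) : f t != 0 -> {for t, continuous f} ->
  {for t, continuous (fun s => (f s)^-1)}.
Proof. by move=> f0 cf; apply: cvgV. Qed.

Lemma continuous_sc (c : R) (f : R -> R) (t : R) : 0 < f t ->
  {for t, continuous f} -> {for t, continuous (fun s => sc c (f s))}.
Proof.
move=> f0 cf; rewrite /sc; apply: cvgMl; apply: cvgD.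
  by apply: cvgMr.
by apply: cvgMr; apply: cvgV => //; rewrite lt0r_neq0.
Qed.

(** Continuity is asked on a neighbourhood of 0 and not only at 0, since a whole interval of
    parameters will become the deformation. *)
Definition unit_germ (f : R -> R) : Prop :=
  f 0 = 1 /\ \forall t \near (0 : R), 0 < f t /\ {for t, continuous f}.

Lemma unit_germ_invr f : unit_germ f -> unit_germ (fun t => (f t)^-1).
Proof.
move=> [f0 nf]; split; first by rewrite f0 invr1.
apply: filterS nf => t [ft cf]; split; first by rewrite invr_gt0.
by apply: continuous_invr => //; rewrite lt0r_neq0.
Qed.

Lemma unit_germ_near (f : R -> R) (x : R) : unit_germ f -> x < 1 ->
  \forall t \near (0 : R), x < f t.
Proof.
move=> [f0 nf] x1; have [_ cf] := nbhs_singleton nf.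
by apply: (cvgr_gt (f 0) cf); rewrite f0.
Qed.

Lemma unit_germ_sc (c : R) f : unit_germ f -> unit_germ (fun t => sc c (f t)).
Proof.
move=> gf; have [f0 nf] := gf; have [_ cf] := nbhs_singleton nf.
have cs : {for 0, continuous (fun s => sc c (f s))}.
  by apply: continuous_sc => //; rewrite f0.
have ns : \forall t \near (0 : R), 0 < sc c (f t).
  by apply: (cvgr_gt (sc c (f 0)) cs); rewrite f0 sc1.
split; first by rewrite f0 sc1.
apply: filterS2 nf ns => t [ft cft] st; split => //.
exact: continuous_sc.
Qed.

(* The solution [y] of [sc c y^-1 = sc b (f t)^-1] that is close to 1. *)
Definition next_time (b c : R) (f : R -> R) (t : R) : R :=
  let w := sc b (f t)^-1 in (1 + c) / (w + Num.sqrt (w ^+ 2 + (c ^+ 2 - 1))).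

(** [next_time] is a root of [(1 - c) * y ^+ 2 - 2 * w * y + (1 + c)], written with the conjugate as
    denominator so that [c = 1] is no exception. At [w = 1] the square root is [c] and the value is
    1. *)
Lemma unit_germ_next (b c : R) f : 0 < c -> unit_germ f ->
  unit_germ (next_time b c f) /\
  \forall t \near (0 : R), sc b (f t)^-1 = sc c (next_time b c f t)^-1.
Proof.
move=> c0 gf; have gw := unit_germ_sc b (unit_germ_invr gf).
set w := fun t => sc b (f t)^-1 in gw; have [w0 nw] := gw.
have c1 : 1 + c != 0 by rewrite lt0r_neq0 // addr_gt0.
have next_timeE t : next_time b c f t = (1 + c) / (w t + Num.sqrt (w t ^+ 2 + (c ^+ 2 - 1))).
  by [].
have sq : \forall t \near (0 : R), 0 < w t ^+ 2 + (c ^+ 2 - 1).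
  have cw : {for (0 : R), continuous (fun t => w t ^+ 2 + (c ^+ 2 - 1))}.
    have [_ cw] := nbhs_singleton nw.
    by apply: cvgD; [apply: cvgM | apply: cvg_cst].
  apply: (cvgr_gt (w 0 ^+ 2 + (c ^+ 2 - 1)) cw).
  by rewrite w0 expr1n addrC subrK exprn_gt0.
split.
  split.
    rewrite next_timeE w0 expr1n addrC addrC [1 + (_ - _)]addrC subrK.
    by rewrite sqrtr_sqr gtr0_norm // divff.
  apply: filterS2 nw sq => t [wt cw] st; rewrite next_timeE.
  have den : 0 < w t + Num.sqrt (w t ^+ 2 + (c ^+ 2 - 1)).
    by rewrite ltr_wpDr // sqrtr_ge0.
  split; first by rewrite divr_gt0 // addr_gt0.
  apply: cvgMr; apply: cvgV; first by rewrite lt0r_neq0.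
  apply: cvgD => //.
  apply: (@continuous_comp _ _ _ (fun t => w t ^+ 2 + (c ^+ 2 - 1)) Num.sqrt).
    by apply: cvgD; [apply: cvgM | apply: cvg_cst].
  exact: sqrt_continuous.
apply: filterS2 nw sq => t [wt _] st; rewrite next_timeE -/(w t).
set r := Num.sqrt _; have r2 : r ^+ 2 = w t ^+ 2 + (c ^+ 2 - 1).
  by rewrite sqr_sqrtr // ltW.
have den : 0 < w t + r by rewrite ltr_wpDr // sqrtr_ge0.
have den0 := lt0r_neq0 den.
rewrite /sc invf_div; apply/eqP; rewrite -subr_eq0; apply/eqP.
transitivity ((w t ^+ 2 + (c ^+ 2 - 1) - r ^+ 2) / (2 * (w t + r))).
  by field; rewrite den0 c1.
by rewrite r2 subrr mul0r.
Qed.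

Definition deformation_family m n (a b : nat -> nat -> R) (X : R -> nat -> nat -> R) :=
  [/\ forall i j, (i < m)%N -> (j < n)%N -> unit_germ (fun t => X t i j),
      \forall t \near (0 : R), compatible m n a b (X t) &
      injective (fun t => X t 0%N 0%N)].

Lemma unit_germ_start : unit_germ (fun t : R => 1 + t).
Proof.
split; first by rewrite addr0.
have c t : {for t, continuous (fun t : R => 1 + t)}.
  by apply: cvgD; [apply: cvg_cst | apply: cvg_id].
near=> t; split => //; near: t.
by apply: (cvgr_gt (1 + 0 : R) (c 0)); rewrite addr0.
Unshelve. all: by end_near. Qed.

(** Faces with the same [i] can share one time, since the slopes on the edges between them agree.
    The remaining equations, from [i] to [i.+1], do not depend on [j] because [b] does not, so one
    recursion solves them all. *)
Lemma deformation_family_12 m n (a b : nat -> nat -> R) :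
  (forall i j, (i < m)%N -> (j < n)%N -> 0 < b i j) ->
  (forall i j, (i < m)%N -> (j.+1 < n)%N ->
     (a i j)^-1 = a i j.+1 /\ b i j = b i j.+1) ->
  exists X, deformation_family m n a b X.
Proof.
move=> b0 H.
pose fix xi (i : nat) : R -> R :=
  if i is i'.+1 then next_time (b i' 0%N) (b i 0%N)^-1 (xi i') else fun t => 1 + t.
exists (fun t i _ => xi i t).
have [n0|n0] := posnP n.
  split; [by rewrite n0 | | by move=> s t /addrI].
  by apply: filterE => t; split => i j; rewrite n0.
have gxi i : (i < m)%N -> unit_germ (xi i).
  elim: i => [_|i IH hi] /=; first exact: unit_germ_start.
  have [||+ _] := @unit_germ_next (b i 0%N) (b i.+1 0%N)^-1 (xi i) => //.
    by rewrite invr_gt0 b0.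
  exact: IH (ltnW hi).
have bE i j : (i < m)%N -> (j < n)%N -> b i j = b i 0%N.
  by move=> hi; elim: j => // j IH hj; rewrite -(H i j hi hj).2 IH // ltnW.
split; [by move=> i j hi _; apply: gxi | | by move=> s t /addrI].
have ne : \forall t \near (0 : R), forall i, (i < m.-1)%N ->
    sc (b i 0%N) (xi i t)^-1 = sc (b i.+1 0%N)^-1 (xi i.+1 t)^-1.
  apply: (@near_all_ltn _ (nbhs (0 : R)) _ m.-1) => i hi.
  have hi' : (i.+1 < m)%N by case: (m) hi.
  have [||_ +] := @unit_germ_next (b i 0%N) (b i.+1 0%N)^-1 (xi i) => //.
    by rewrite invr_gt0 b0.
  exact: gxi (ltnW hi').
apply: filterS ne => t ht; split => i j hi hj; first by rewrite (H i j hi hj).1.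
by rewrite (bE i j) ?(bE i.+1 j) ?(ltnW hi) // ht //; case: (m) hi.
Qed.

Lemma deformation_family_tr m n (a b : nat -> nat -> R) X :
  deformation_family n m (fun i j => (b j i)^-1) (fun i j => (a j i)^-1) X ->
  deformation_family m n a b (fun t i j => (X t j i)^-1).
Proof.
case=> gX cX iX; split.
- by move=> i j hi hj; apply/unit_germ_invr/gX.
- apply: filterS cX => t [cU cV]; split => i j hi hj.
    by have := cV j i hj hi; rewrite !invrK.
  by have := cU j i hj hi; rewrite !invrK.
- by move=> s t /invr_inj /iX.
Qed.

Lemma deformation_family_exists m n (a b : nat -> nat -> R) :
  (forall i j, (i < m)%N -> (j < n)%N -> 0 < a i j) ->
  (forall i j, (i < m)%N -> (j < n)%N -> 0 < b i j) ->
  [\/ forall i j, (i < m)%N -> (j.+1 < n)%N ->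
        (a i j)^-1 = a i j.+1 /\ b i j = b i j.+1,
      forall i j, (i.+1 < m)%N -> (j < n)%N ->
        b i j = (b i.+1 j)^-1 /\ a i j = a i.+1 j |
      (forall i j, (i < m)%N -> (j.+1 < n)%N -> (a i j)^-1 = a i j.+1) /\
      (forall i j, (i.+1 < m)%N -> (j < n)%N -> b i j = (b i.+1 j)^-1)] ->
  exists X, deformation_family m n a b X.
Proof.
move=> a0 b0 [H|H|[HU HV]]; first exact: deformation_family_12.
- have [|i j hi hj|X gX] := @deformation_family_12 n m (fun i j => (b j i)^-1)
      (fun i j => (a j i)^-1).
  + by move=> i j hi hj; rewrite invr_gt0 a0.
  + by have [-> ->] := H j i hj hi; rewrite !invrK.
  + by exists (fun t i j => (X t j i)^-1); apply: deformation_family_tr.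
- exists (fun t _ _ => 1 + t); split.
  + by move=> i j _ _; apply: unit_germ_start.
  + apply: filterE => t; split => i j hi hj; first by rewrite (HU i j hi hj).
    by rewrite (HV i j hi hj).
  + by move=> s t /addrI.
Qed.

End Family.

(** * Shape parameters of convex quadrilaterals *)

Section Geometry.
Variables (R : realType) (d : nat).
Implicit Types (u v A B C D F G : 'rV[R]_d).

Definition free2 u v : Prop :=
  forall x y : R, x *: u + y *: v = 0 -> x = 0 /\ y = 0.

Lemma free2P u v : free2 u v <-> row_free (col_mx u v).
Proof.
split=> [fr|fr x y E].
  apply: inj_row_free => w; rewrite -[w]hsubmxK mul_row_col.
  set x := lsubmx w; set y := rsubmx w.
  rewrite [x]mx11_scalar [y]mx11_scalar !mul_scalar_mx => /fr[-> ->].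
  by rewrite !raddf0 row_mx0.
have : row_mx (x%:M : 'M[R]_1) (y%:M : 'M[R]_1) *m col_mx u v = 0 *m col_mx u v.
  by rewrite mul_row_col !mul_scalar_mx mul0mx.
move=> /(row_free_inj fr) /eqP; rewrite -row_mx0 => /eqP /eq_row_mx[].
move=> /matrixP/(_ 0 0) + /matrixP/(_ 0 0).
by rewrite !mxE eqxx !mulr1n.
Qed.

Lemma not_parallelP u v : ~ parallel_vec u v <-> free2 u v.
Proof.
rewrite free2P /parallel_vec /row_free.
have := rank_leq_row (col_mx u v).
by case: (mxrank _) => [|[|[|k]]] //= _; split.
Qed.

Lemma parallel_scale u v : u != 0 -> parallel_vec u v -> exists k, v = k *: u.
Proof.
move=> u0 par; apply: contrapT => H.
suff /not_parallelP : free2 u v by [].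
move=> x y E; have y0 : y = 0.
  apply: contrapT => /eqP y0; apply: H; exists (- (y^-1 * x)).
  apply: (scalerI y0); rewrite scaleNr scalerN scalerA mulVKf //.
  by apply/eqP; rewrite -addr_eq0 addrC E.
move: E; rewrite y0 scale0r addr0 => /eqP.
by rewrite scaler_eq0 (negbTE u0) orbF => /eqP.
Qed.

Lemma scale_parallel (k l : R) u : parallel_vec (k *: u) (l *: u).
Proof.
apply: contrapT => /not_parallelP fr.
have [_ /eqP] : l = 0 /\ - k = 0.
  by apply: fr; rewrite !scalerA mulNr [k * l]mulrC scaleNr subrr.
rewrite oppr_eq0 => /eqP k0; have [|/eqP] := fr 1 0; last by rewrite oner_eq0.
by rewrite k0 !scale0r !scaler0 addr0.
Qed.

Lemma free2_comb F G (x1 y1 x2 y2 : R) :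
  free2 (x1 *: F + y1 *: G) (x2 *: F + y2 *: G) <->
  free2 F G /\ x1 * y2 - x2 * y1 != 0.
Proof.
split=> [fr|[fr det] x y].
  have det : x1 * y2 - x2 * y1 != 0.
    apply/negP => /eqP det.
    have [] := fr y2 (- y1).
      transitivity ((x1 * y2 - x2 * y1) *: F); last by rewrite det scale0r.
      by apply/rowP => k; rewrite !mxE; ring.
    move=> y20 /eqP; rewrite oppr_eq0 => /eqP y10.
    have [] := fr x2 (- x1).
      transitivity (- (x1 * y2 - x2 * y1) *: G); last by rewrite det oppr0 scale0r.
      by apply/rowP => k; rewrite !mxE; ring.
    move=> x20 /eqP; rewrite oppr_eq0 => /eqP x10.
    have [|/eqP] := fr 1 0; last by rewrite oner_eq0.
    by rewrite y20 y10 x20 x10 !scale0r !addr0 !scaler0.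
  split=> // x y E.
  have [] := fr (x * y2 - y * x2) (y * x1 - x * y1).
    transitivity ((x1 * y2 - x2 * y1) *: (x *: F + y *: G)).
      by apply/rowP => k; rewrite !mxE; ring.
    by rewrite E scaler0.
  move=> e1 e2; split; apply: (mulfI det); rewrite mulr0.
    by transitivity (x1 * (x * y2 - y * x2) + x2 * (y * x1 - x * y1));
       [ring | rewrite e1 e2 !mulr0 addr0].
  by transitivity (y1 * (x * y2 - y * x2) + y2 * (y * x1 - x * y1));
     [ring | rewrite e1 e2 !mulr0 addr0].
move=> E; have [] := fr (x * x1 + y * x2) (x * y1 + y * y2).
  by rewrite -E; apply/rowP => k; rewrite !mxE; ring.
move=> e1 e2; split; apply: (mulfI det); rewrite mulr0.
  by transitivity (y2 * (x * x1 + y * x2) - x2 * (x * y1 + y * y2));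
     [ring | rewrite e1 e2 !mulr0 subrr].
by transitivity (x1 * (x * y1 + y * y2) - y1 * (x * x1 + y * x2));
   [ring | rewrite e1 e2 !mulr0 subrr].
Qed.

Lemma segP A B X : seg A B X <-> exists2 t : R, 0 <= t <= 1 & X = A + t *: (B - A).
Proof.
split=> [[t /= + <-]|[t t01 ->]].
  rewrite in_itv /= => t01; exists t => //.
  by apply/rowP => k; rewrite !mxE; ring.
by exists t; [rewrite /= in_itv | apply/rowP => k; rewrite !mxE; ring].
Qed.

Lemma not_collinear_comb A B C F G (x1 y1 x2 y2 : R) :
  B - A = x1 *: F + y1 *: G -> C - A = x2 *: F + y2 *: G ->
  ~ collinear A B C <-> free2 F G /\ x1 * y2 - x2 * y1 != 0.
Proof. by rewrite /collinear not_parallelP => -> ->; apply: free2_comb. Qed.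

(** [t] and [s] locate the crossing of the diagonals on AC and on BD. In the frame of the diagonals,
    the four collinearities amount to the vanishing of [s], [1 - t], [1 - s] and [t]. *)
Lemma convex_quadP A B C D : convex_quad A B C D <->
  exists t s : R, [/\ 0 < t < 1, 0 < s < 1, free2 (C - A) (D - B) &
    B - A = t *: (C - A) - s *: (D - B)].
Proof.
have key (t s : R) : B - A = t *: (C - A) - s *: (D - B) ->
  [/\ ~ collinear A B C <-> free2 (C - A) (D - B) /\ s != 0,
      ~ collinear B C D <-> free2 (C - A) (D - B) /\ 1 - t != 0,
      ~ collinear C D A <-> free2 (C - A) (D - B) /\ 1 - s != 0 &
      ~ collinear D A B <-> free2 (C - A) (D - B) /\ t != 0].
  set F := C - A; set G := D - B => E.
  have CE : C = A + F by rewrite addrC subrK.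
  have BE : B = A + (t *: F - s *: G) by rewrite -E addrC subrK.
  have DE : D = A + (t *: F + (1 - s) *: G).
    have -> : D = B + G by rewrite addrC subrK.
    by rewrite {1}BE; apply/rowP => k; rewrite !mxE; ring.
  clearbody F G; split.
  - rewrite (@not_collinear_comb _ _ _ F G t (- s) 1 0).
    + by have -> : t * 0 - 1 * - s = s by ring.
    + by rewrite BE; apply/rowP => k; rewrite !mxE; ring.
    + by rewrite CE; apply/rowP => k; rewrite !mxE; ring.
  - rewrite (@not_collinear_comb _ _ _ F G (1 - t) s 0 1).
    + by have -> : (1 - t) * 1 - 0 * s = 1 - t by ring.
    + by rewrite BE CE; apply/rowP => k; rewrite !mxE; ring.
    + by rewrite BE DE; apply/rowP => k; rewrite !mxE; ring.
  - rewrite (@not_collinear_comb _ _ _ F G (t - 1) (1 - s) (-1) 0).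
    + by have -> : (t - 1) * 0 - -1 * (1 - s) = 1 - s by ring.
    + by rewrite CE DE; apply/rowP => k; rewrite !mxE; ring.
    + by rewrite CE; apply/rowP => k; rewrite !mxE; ring.
  - rewrite (@not_collinear_comb _ _ _ F G (- t) (s - 1) 0 (-1)).
    + by have -> : - t * -1 - 0 * (s - 1) = t by ring.
    + by rewrite DE; apply/rowP => k; rewrite !mxE; ring.
    + by rewrite BE DE; apply/rowP => k; rewrite !mxE; ring.
split=> [[nABC nBCD nCDA nDAB [Q [/segP[t t01 QE] /segP[s s01 QE']]]]|].
  have E : B - A = t *: (C - A) - s *: (D - B).
    apply/eqP; rewrite -(inj_eq (addrI (A + s *: (D - B)))); apply/eqP.
    transitivity (B + s *: (D - B)); first by apply/rowP => k; rewrite !mxE; ring.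
    by rewrite -QE' QE; apply/rowP => k; rewrite !mxE; ring.
  have [/iffLR/(_ nABC)[fr s0] /iffLR/(_ nBCD)[_ t1] /iffLR/(_ nCDA)[_ s1]
    /iffLR/(_ nDAB)[_ t0]] := key t s E.
  move: t01 s01 => /andP[t0' t1'] /andP[s0' s1'].
  exists t, s; split => //.
    by rewrite !lt_neqAle t0' t1' eq_sym t0 -subr_eq0 -oppr_eq0 opprB t1.
  by rewrite !lt_neqAle s0' s1' eq_sym s0 -subr_eq0 -oppr_eq0 opprB s1.
move=> [t [s [/andP[t0 t1] /andP[s0 s1] fr E]]].
have [kA kB kC kD] := key t s E.
split; [apply/kA | apply/kB | apply/kC | apply/kD |]; try split=> //.
- by rewrite lt0r_neq0.
- by rewrite subr_eq0 eq_sym lt_eqF.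
- by rewrite subr_eq0 eq_sym lt_eqF.
- by rewrite lt0r_neq0.
exists (A + t *: (C - A)); split; apply/segP.
  by exists t => //; rewrite !ltW.
exists s; first by rewrite !ltW.
apply/eqP; rewrite -(inj_eq (addrI (- A - s *: (D - B)))); apply/eqP.
transitivity (t *: (C - A) - s *: (D - B)); first by apply/rowP => k; rewrite !mxE; ring.
by rewrite -E; apply/rowP => k; rewrite !mxE; ring.
Qed.
End Geometry.

Section Shape.
Variables (R : realType) (d : nat).
Implicit Types (u v A B C D F G : 'rV[R]_d).

(* [a], [- b], [a^-1] and [- b^-1] are the slopes of AB, BC, CD and DA. *)
Definition shape A B C D (a b : R) : Prop :=
  [/\ 0 < a, 0 < b, free2 (C - A) (D - B) &
      B - A = (b / (a + b)) *: (C - A) - (1 + a * b)^-1 *: (D - B)].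

Lemma free2_eq F G (x y x' y' : R) : free2 F G ->
  x *: F + y *: G = x' *: F + y' *: G -> x = x' /\ y = y'.
Proof.
move=> fr E; have [|/eqP + /eqP] := fr (x - x') (y - y').
  transitivity (x *: F + y *: G - (x' *: F + y' *: G)); last by rewrite E subrr.
  by apply/rowP => k; rewrite !mxE; ring.
by rewrite !subr_eq0 => /eqP -> /eqP ->.
Qed.

Lemma convex_quad_shape A B C D : convex_quad A B C D ->
  exists a b, shape A B C D a b.
Proof.
move=> /convex_quadP[t [s [/andP[t0 t1] /andP[s0 s1] fr E]]].
have t1' : 0 < 1 - t by rewrite subr_gt0.
have s1' : 0 < 1 - s by rewrite subr_gt0.
(* The equations [t = b / (a + b)] and [s = (1 + a * b)^-1] mean [b / a = t / (1 - t)] and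
   [a * b = (1 - s) / s]; the quotient gives [a ^+ 2]. *)
pose a2 := (1 - t) * (1 - s) / (t * s).
have a20 : 0 < a2 by rewrite divr_gt0 ?mulr_gt0.
pose a := Num.sqrt a2; pose b := a * t / (1 - t).
have a0 : 0 < a by rewrite sqrtr_gt0.
have aa : a * a = a2 by rewrite -expr2 sqr_sqrtr // ltW.
exists a, b; split=> //; first by rewrite divr_gt0 ?mulr_gt0.
have -> : b / (a + b) = t.
  rewrite /b; field; rewrite !lt0r_neq0 //.
  by have -> : a * (1 - t) + a * t = a by ring.
have -> : 1 + a * b = s^-1.
  by rewrite /b !mulrA aa /a2; field; rewrite !lt0r_neq0.
by rewrite invrK.
Qed.

Lemma shape_frame A B C D a b : shape A B C D a b ->
  exists F G, [/\ free2 F G,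
    B = A + ((b / (a + b)) *: F + (- (1 + a * b)^-1) *: G), C = A + F &
    D = A + ((b / (a + b)) *: F + (a * b / (1 + a * b)) *: G)].
Proof.
move=> [a0 b0 fr E]; exists (C - A), (D - B).
have BE : B = A + ((b / (a + b)) *: (C - A) + (- (1 + a * b)^-1) *: (D - B)).
  by rewrite scaleNr -E addrC subrK.
split=> //; first by rewrite addrC subrK.
have ab1 : 1 + a * b != 0 by rewrite lt0r_neq0 // addr_gt0 ?mulr_gt0.
have -> : a * b / (1 + a * b) = 1 - (1 + a * b)^-1 by field.
apply: (addIr (- (D - B))); rewrite {1}opprB addrC subrK {1}BE.
by apply/rowP => k; rewrite !mxE; ring.
Qed.

Lemma shape_neq0 (a b : R) : 0 < a -> 0 < b ->
  [/\ a != 0, b != 0, a + b != 0 & 1 + a * b != 0].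
Proof. by move=> a0 b0; rewrite !lt0r_neq0 // addr_gt0 ?mulr_gt0. Qed.

(** Relabellings bring any side of a face into first position, as opposite ratios and affine
    symmetry require. *)
Lemma shape_DCBA A B C D a b : shape A B C D a b -> shape D C B A a^-1 b.
Proof.
move=> H; have [a0 b0 _ _] := H; have [an bn abn ab1n] := shape_neq0 a0 b0.
have [F [G [fr BE CE DE]]] := shape_frame H; subst.
split; rewrite ?invr_gt0 //.
  set u := _ - _; set v := _ - _.
  have -> : u = 0 *: F + (-1) *: G.
    by apply/rowP => k; rewrite !mxE; field; rewrite ?an ?bn ?abn ?ab1n.
  have -> : v = (-1) *: F + 0 *: G.
    by apply/rowP => k; rewrite !mxE; field; rewrite ?an ?bn ?abn ?ab1n.
  by apply/free2_comb; split => //; rewrite !mulr0 mulrNN mulr1 sub0r oppr_eq0 oner_eq0.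
have -> : b / (a^-1 + b) = a * b / (1 + a * b).
  by field; rewrite an ab1n.
have -> : (1 + a^-1 * b)^-1 = a / (a + b).
  by field; rewrite an abn.
by apply/rowP => k; rewrite !mxE; field; rewrite ?an ?bn ?abn ?ab1n.
Qed.

Lemma shape_BCDA A B C D a b : shape A B C D a b -> shape B C D A b a^-1.
Proof.
move=> H; have [a0 b0 _ _] := H; have [an bn abn ab1n] := shape_neq0 a0 b0.
have [F [G [fr BE CE DE]]] := shape_frame H; subst.
split; rewrite ?invr_gt0 //.
  set u := _ - _; set v := _ - _.
  have -> : u = 0 *: F + 1 *: G.
    by apply/rowP => k; rewrite !mxE; field; rewrite ?an ?bn ?abn ?ab1n.
  have -> : v = (-1) *: F + 0 *: G.
    by apply/rowP => k; rewrite !mxE; field; rewrite ?an ?bn ?abn ?ab1n.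
  by apply/free2_comb; split => //; rewrite !mulr0 mulN1r opprK add0r oner_eq0.
have -> : a^-1 / (b + a^-1) = (1 + a * b)^-1.
  by field; rewrite an ab1n.
have -> : (1 + b * a^-1)^-1 = a / (a + b).
  by field; rewrite an abn.
by apply/rowP => k; rewrite !mxE; field; rewrite ?an ?bn ?abn ?ab1n.
Qed.

Lemma shape_ADCB A B C D a b : shape A B C D a b -> shape A D C B b^-1 a^-1.
Proof. by move=> /shape_DCBA /shape_BCDA /shape_BCDA /shape_BCDA; rewrite invrK. Qed.

End Shape.

(** * Areas, opposite ratios and faces with scaled sides *)

Section Area.
Variables (R : realType) (d : nat).
Implicit Types (u v A B C D F G : 'rV[R]_d).

Definition gram u v : R := dot u u * dot v v - dot u v ^+ 2.

Lemma dot_comb F G (x1 y1 x2 y2 : R) :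
  dot (x1 *: F + y1 *: G) (x2 *: F + y2 *: G) =
  x1 * x2 * dot F F + (x1 * y2 + y1 * x2) * dot F G + y1 * y2 * dot G G.
Proof.
rewrite /dot !mulr_sumr -!big_split /=; apply: eq_bigr => k _.
by rewrite !mxE; ring.
Qed.

Lemma gram_comb F G (x1 y1 x2 y2 : R) :
  gram (x1 *: F + y1 *: G) (x2 *: F + y2 *: G) = (x1 * y2 - x2 * y1) ^+ 2 * gram F G.
Proof. by rewrite /gram !dot_comb; ring. Qed.

Lemma dot_gt0 u : u != 0 -> 0 < dot u u.
Proof.
move=> u0; have ge k : 0 <= u 0 k * u 0 k by rewrite -expr2 sqr_ge0.
rewrite lt_def sumr_ge0 ?andbT //; apply: contraNneq u0 => /eqP.
rewrite psumr_eq0 // => /allP u0; apply/eqP/rowP => k; rewrite mxE.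
by have := u0 k (mem_index_enum _); rewrite mulf_eq0 orbb => /eqP.
Qed.

Lemma free2_neq0 F G : free2 F G -> F != 0.
Proof.
move=> fr; apply/negP => /eqP F0; have [|/eqP] := fr 1 0.
  by rewrite F0 scaler0 scale0r addr0.
by rewrite oner_eq0.
Qed.

Lemma gram_gt0 F G : free2 F G -> 0 < gram F G.
Proof.
move=> fr; have F0 := dot_gt0 (free2_neq0 fr).
rewrite -(pmulr_rgt0 _ F0).
(* The vector is [dot F F] times the component of [G] orthogonal to [F]. *)
have -> : dot F F * gram F G = dot ((- dot F G) *: F + dot F F *: G)
    ((- dot F G) *: F + dot F F *: G) by rewrite dot_comb /gram; ring.
apply: dot_gt0; apply/negP => /eqP /fr[_ /eqP].
by rewrite gt_eqF.
Qed.

Lemma tri_area_comb A B C F G (x1 y1 x2 y2 : R) :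
  B - A = x1 *: F + y1 *: G -> C - A = x2 *: F + y2 *: G ->
  tri_area A B C = `|x1 * y2 - x2 * y1| * Num.sqrt (gram F G) / 2.
Proof.
rewrite /tri_area => -> ->; rewrite -/(gram _ _) gram_comb.
by rewrite sqrtrM ?sqr_ge0 // sqrtr_sqr.
Qed.

(** In the frame of the diagonals the two triangles have areas proportional to [t * s] and
    [(1 - t) * (1 - s)], and the second product is [a ^+ 2] times the first. *)
Lemma opposite_ratio_shape A B C D a b : shape A B C D a b ->
  opposite_ratio A B C D = (a ^+ 2)^-1.
Proof.
move=> H; have [a0 b0 _ _] := H; have [an bn abn ab1n] := shape_neq0 a0 b0.
have [F [G [fr BE CE DE]]] := shape_frame H.
pose t := b / (a + b); pose s := (1 + a * b)^-1.
have QE : diag_point A B C D = A + t *: F.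
  rewrite /diag_point; set S := _ `&` _.
  have QS : S (A + t *: F).
    split; apply/segP.
      exists t; last by rewrite CE [A + F]addrC addrK.
      apply/andP; split; first by rewrite divr_ge0 ?ltW ?addr_gt0.
      by rewrite ler_pdivrMr ?addr_gt0 // mul1r lerDr ltW.
    exists s; last first.
      rewrite BE DE; apply/rowP => k; rewrite !mxE /s /t.
      by field; rewrite abn ab1n.
    apply/andP; split; first by rewrite invr_ge0 ltW // addr_gt0 ?mulr_gt0.
    by rewrite invf_le1 ?addr_gt0 ?mulr_gt0 // lerDl ltW // mulr_gt0.
  have [/segP[x _ Ex] /segP[y _ Ey]] : S (xget 0 S) := xgetPex 0 (ex_intro _ _ QS).
  suff [xt _] : x = t /\ 0 = y - s by rewrite Ex xt CE [A + F]addrC addrK.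
  apply: (free2_eq fr).
  transitivity (xget 0 S - A).
    by rewrite Ex CE; apply/rowP => k; rewrite !mxE; ring.
  by rewrite Ey BE DE; apply/rowP => k; rewrite !mxE /s /t; field; rewrite abn ab1n.
rewrite /opposite_ratio QE.
rewrite (@tri_area_comb _ _ _ F G t 0 t (- s)); first last.
- by rewrite BE; apply/rowP => k; rewrite !mxE /t /s; ring.
- by apply/rowP => k; rewrite !mxE; ring.
rewrite (@tri_area_comb _ _ _ F G (t - 1) 0 (t - 1) (1 - s)); first last.
- by rewrite CE DE; apply/rowP => k; rewrite !mxE /t /s; field; rewrite abn ab1n.
- by rewrite CE; apply/rowP => k; rewrite !mxE; ring.
have g0 : Num.sqrt (gram F G) != 0 by rewrite gt_eqF // sqrtr_gt0 gram_gt0.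
have -> : t * - s - t * 0 = - (t * s) by ring.
have -> : (t - 1) * (1 - s) - (t - 1) * 0 = - (a ^+ 2 * (t * s)).
  by rewrite /t /s; field; rewrite abn ab1n.
have tp : 0 < t by rewrite divr_gt0 ?addr_gt0.
have sp : 0 < s by rewrite invr_gt0 addr_gt0 ?mulr_gt0.
have t0 : 0 < t * s by rewrite mulr_gt0.
have t2 : 0 < a ^+ 2 * (t * s) by rewrite mulr_gt0 // exprn_gt0.
rewrite !normrN (gtr0_norm t0) (gtr0_norm t2).
have tn := lt0r_neq0 tp; have sn := lt0r_neq0 sp.
by field; rewrite g0 an tn sn.
Qed.

Definition scaled_face A B C D A' B' C' D' (al be ga de : R) : Prop :=
  [/\ B' - A' = al *: (B - A), C' - B' = be *: (C - B),
      D' - C' = ga *: (D - C) & A' - D' = de *: (A - D)].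

Lemma scaled_face_closed A B C D A' B' C' D' a b al be ga de :
  shape A B C D a b -> scaled_face A B C D A' B' C' D' al be ga de ->
  b * (al - de) = a * (ga - be) /\ al - be = a * b * (ga - de).
Proof.
move=> H; have [a0 b0 _ _] := H; have [an bn abn ab1n] := shape_neq0 a0 b0.
have [F [G [fr BE CE DE]]] := shape_frame H.
move=> [E1 E2 E3 E4].
have : al *: (B - A) + be *: (C - B) + ga *: (D - C) + de *: (A - D) = 0.
  by rewrite -E1 -E2 -E3 -E4; apply/rowP => k; rewrite !mxE; ring.
rewrite BE CE DE => E.
have [] := fr ((b * (al - de) - a * (ga - be)) / (a + b))
   ((be - al + a * b * (ga - de)) / (1 + a * b)).
  by rewrite -E; apply/rowP => k; rewrite !mxE; field; rewrite abn ab1n.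
move=> /eqP; rewrite mulf_eq0 invr_eq0 (negbTE abn) orbF subr_eq0 => /eqP ->.
move=> /eqP; rewrite mulf_eq0 invr_eq0 (negbTE ab1n) orbF -opprB addrC subr_eq0.
by move=> /eqP ->.
Qed.

(** The diagonal AC cuts the original face into triangles with areas in the ratio [1 : a * b].
    Positive scales preserve the orientation of both, so each area is multiplied by the product of
    its two scales. *)
Lemma scaled_face_area A B C D A' B' C' D' a b al be ga de :
  shape A B C D a b -> scaled_face A B C D A' B' C' D' al be ga de ->
  0 < al -> 0 < be -> 0 < ga -> 0 < de ->
  exists2 g, 0 < g &
    quad_area A' B' C' D' = (al * be + a * b * (ga * de)) * g /\
    quad_area A B C D = (1 + a * b) * g.
Proof.
move=> H; have [a0 b0 _ _] := H; have [an bn abn ab1n] := shape_neq0 a0 b0.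
have [F [G [fr BE CE DE]]] := shape_frame H.
move=> [E1 E2 E3 E4] al0 be0 ga0 de0.
have ab1 : 0 < 1 + a * b by rewrite addr_gt0 ?mulr_gt0.
exists (Num.sqrt (gram F G) / 2 / (1 + a * b)).
  by rewrite !divr_gt0 // sqrtr_gt0 gram_gt0.
have area P Q S T (x y z w : R) : 0 < x -> 0 < y -> 0 < z -> 0 < w ->
    Q - P = x *: (B - A) -> S - Q = y *: (C - B) -> T - S = z *: (D - C) ->
    P - T = w *: (A - D) ->
    quad_area P Q S T = (x * y + a * b * (z * w)) *
      (Num.sqrt (gram F G) / 2 / (1 + a * b)).
  move=> x0 y0 z0 w0 e1 e2 e3 e4.
  pose t := b / (a + b); pose s := (1 + a * b)^-1.
  have s1 : 1 - s = a * b / (1 + a * b) by rewrite /s; field.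
  rewrite /quad_area.
  rewrite (@tri_area_comb P Q S F G (x * t) (- (x * s))
     (x * t + y * (1 - t)) (y * s - x * s)); first last.
  - have -> : S - P = (Q - P) + (S - Q) 
      by apply/rowP => k; rewrite !mxE; ring.
    by rewrite e1 e2 BE CE; apply/rowP => k; rewrite !mxE /t /s; ring.
  - by rewrite e1 BE; apply/rowP => k; rewrite !mxE /t /s; ring.
  rewrite (@tri_area_comb P S T F G (z * (1 - t) + w * t) (w * (1 - s) - z * (1 - s))
      (w * t) (w * (1 - s))); first last.
  - have -> : T - P = - (P - T) by rewrite opprB.
    by rewrite e4 DE s1; apply/rowP => k; rewrite !mxE /t; ring.
  - have -> : S - P = - (P - T) - (T - S) 
      by apply/rowP => k; rewrite !mxE; ring.
    by rewrite e3 e4 DE CE s1; apply/rowP => k; rewrite !mxE /t; ring.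
  have -> : x * t * (y * s - x * s) - (x * t + y * (1 - t)) * - (x * s) = x * y * s.
    by ring.
  have -> : (z * (1 - t) + w * t) * (w * (1 - s)) - w * t * (w * (1 - s) - z * (1 - s))
    = z * w * (1 - s) by ring.
  rewrite !ger0_norm ?s1 ?mulr_ge0 ?ltW ?invr_gt0 ?mulr_gt0 //.
  by rewrite /s; field.
split; first exact: area.
have := @area A B C D 1 1 1 1; rewrite !scale1r !mulr1; exact.
Qed.

(* The relation between the scale factors of the sides of a face and the area
   constraint cut out a hyperbola, parametrized here by [X]. *)
Lemma face_parameter (a b al be ga de : R) :
  0 < a -> 0 < b -> 0 < al -> 0 < be ->
  b * (al - de) = a * (ga - be) -> al - be = a * b * (ga - de) ->
  al * be + a * b * (ga * de) = 1 + a * b ->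
  let X := ((b + 1) * al + (a - 1) * be) / (a + b) in
  [/\ 0 < X, al = sc a X, be = sc b X^-1, ga = sc a^-1 X & de = sc b^-1 X^-1].
Proof.
move=> a0 b0 al0 be0; have [an bn abn ab1n] := shape_neq0 a0 b0.
(* [X] and [Y] invert the linear change from [X] and [X^-1] to the two scales. The area constraint
   becomes [X * Y = 1], and the positivity of [X + Y] selects the branch. *)
move=> e1 e2 e3 X; pose Y := ((b - 1) * al + (a + 1) * be) / (a + b).
have gaE : ga = (b * al + a * be + (al - be) / a) / (a + b).
  have gd : ga - de = (al - be) / (a * b) by rewrite e2 mulrC mulKf // mulf_neq0.
  have -> : ga = (a * ga + b * de + b * (ga - de)) / (a + b) by field.
  rewrite gd; have -> : a * ga + b * de = b * al + a * be by lra.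
  by field; rewrite an bn abn.
have deE : de = (b * al + a * be - (al - be) / b) / (a + b).
  have gd : ga - de = (al - be) / (a * b) by rewrite e2 mulrC mulKf // mulf_neq0.
  have -> : de = (a * ga + b * de - a * (ga - de)) / (a + b) by field.
  rewrite gd; have -> : a * ga + b * de = b * al + a * be by lra.
  by field; rewrite an bn abn.
have XY : X * Y = 1.
  have : (al * be + a * b * (ga * de)) / (1 + a * b) = 1 by rewrite e3 divff.
  by rewrite gaE deE => <-; rewrite /X /Y; field; rewrite ?an ?bn ?abn ?ab1n.
have XY2 : 0 < X + Y.
  have -> : X + Y = 2 * (b * al + a * be) / (a + b) by rewrite /X /Y; field.
  by rewrite divr_gt0 ?mulr_gt0 ?addr_gt0 ?mulr_gt0.
have X0 : 0 < X.
  have [//|X0|X0] := ltgtP 0 X; last first.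
    by move/eqP: XY; rewrite -X0 mul0r eq_sym oner_eq0.
  have : 0 < X * Y by rewrite XY.
  by rewrite nmulr_rgt0 // => /(ltrD X0); rewrite addr0 ltNge (ltW XY2).
have YE : X^-1 = Y by apply: (mulfI (lt0r_neq0 X0)); rewrite XY divff // lt0r_neq0.
have scE c : sc c X = ((1 + c) * X + (1 - c) * Y) / 2 by rewrite /sc YE.
have scE' c : sc c X^-1 = ((1 + c) * Y + (1 - c) * X) / 2 by rewrite /sc invrK YE.
rewrite !scE !scE' gaE deE; split=> //; rewrite /X /Y; field;
  by rewrite ?an ?bn ?abn ?ab1n.
Qed.

(** Each diagonal is cut by the other in the ratio of the areas on the two sides of the other. With
    the total area normalized to 1, [S1] and [S2] add up these areas for AC and BD, so the two
    crossing parameters are [al * de * t] and [al * be * s], both between 0 and 1. *)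
Lemma scaled_face_convex A B C D A' B' C' D' a b X :
  shape A B C D a b -> 0 < X ->
  0 < sc a X -> 0 < sc b X^-1 -> 0 < sc a^-1 X -> 0 < sc b^-1 X^-1 ->
  scaled_face A B C D A' B' C' D' (sc a X) (sc b X^-1) (sc a^-1 X) (sc b^-1 X^-1) ->
  convex_quad A' B' C' D' /\ quad_area A' B' C' D' = quad_area A B C D.
Proof.
move=> H X0 al0 be0 ga0 de0 SF.
have [a0 b0 _ _] := H; have [an bn abn ab1n] := shape_neq0 a0 b0.
have Xn := lt0r_neq0 X0; split; last first.
  have [g _ [-> ->]] := scaled_face_area H SF al0 be0 ga0 de0.
  by congr (_ * _); rewrite /sc; field; rewrite ?an ?bn ?Xn.
have [F [G [fr BE CE DE]]] := shape_frame H.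
have [E1 E2 E3 E4] := SF.
set al := sc a X in al0 E1 SF; set be := sc b _ in be0 E2 SF.
set ga := sc _ X in ga0 E3 SF; set de := sc _ X^-1 in de0 E4 SF.
pose t := b / (a + b); pose s := (1 + a * b)^-1.
have S1 : al * be * s + ga * de * (1 - s) = 1.
  by rewrite /al /be /ga /de /s /sc; field; rewrite ?an ?bn ?Xn ?abn ?ab1n.
have S2 : al * de * t + be * ga * (1 - t) = 1.
  by rewrite /al /be /ga /de /t /sc; field; rewrite ?an ?bn ?Xn ?abn ?ab1n.
have t0 : 0 < t by rewrite divr_gt0 ?addr_gt0.
have s0 : 0 < s by rewrite invr_gt0 addr_gt0 ?mulr_gt0.
have s1E : 1 - s = a * b / (1 + a * b) by rewrite /s; field.
have s1 : 0 < 1 - s by rewrite s1E divr_gt0 ?addr_gt0 ?mulr_gt0.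
have t1 : 0 < 1 - t.
  have -> : 1 - t = a / (a + b) by rewrite /t; field.
  by rewrite divr_gt0 ?addr_gt0.
have CA : C' - A' = (al * t + be * (1 - t)) *: F + (be * s - al * s) *: G.
  have -> : C' - A' = (B' - A') + (C' - B') 
      by apply/rowP => k; rewrite !mxE; ring.
  by rewrite E1 E2 BE CE; apply/rowP => k; rewrite !mxE /t /s; ring.
have DB : D' - B' = (be * (1 - t) - ga * (1 - t)) *: F + (be * s + ga * (1 - s)) *: G.
  have -> : D' - B' = (C' - B') + (D' - C') 
      by apply/rowP => k; rewrite !mxE; ring.
  by rewrite E2 E3 BE CE DE s1E; apply/rowP => k; rewrite !mxE /t /s; ring.
apply/convex_quadP; exists (al * de * t), (al * be * s); split.
- apply/andP; split; first exact: mulr_gt0 (mulr_gt0 al0 de0) t0.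
  by rewrite -[X in _ < X]S2 ltrDl; exact: mulr_gt0 (mulr_gt0 be0 ga0) t1.
- apply/andP; split; first exact: mulr_gt0 (mulr_gt0 al0 be0) s0.
  by rewrite -[X in _ < X]S1 ltrDl; exact: mulr_gt0 (mulr_gt0 ga0 de0) s1.
- rewrite CA DB; apply/free2_comb; split => //.
  set det := _ - _; have -> : det = 1; last by rewrite oner_eq0.
  by rewrite /det /al /be /ga /t /s /sc; field; rewrite ?an ?bn ?Xn ?abn ?ab1n.
rewrite CA DB E1 BE; apply/rowP => k; rewrite !mxE /al /be /ga /de /t /s /sc.
by field; rewrite ?an ?bn ?Xn ?abn ?ab1n.
Qed.

End Area.

(** * Affine symmetry in terms of the shape parameters *)

Section AffineSymmetry.
Variables (R : realType) (d : nat).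
Implicit Types (u v A B C D F G : 'rV[R]_d).

Lemma convex_setP (S : set 'rV[R]_d) :
  @convex_set R 'rV[R]_d S <->
  forall u v (t : R), 0 <= t <= 1 -> S u -> S v -> S (t *: u + (1 - t) *: v).
Proof.
split=> [cS u v t /andP[t0 t1] Su Sv|cS u v t /set_mem Su /set_mem Sv].
  by have := cS u v (Itv01 t0 t1) (mem_set Su) (mem_set Sv) => /set_mem.
by apply/mem_set; apply: (cS u v t%:num) => //; apply/andP.
Qed.

Definition affine (M : 'M[R]_d) (c : 'rV[R]_d) := fun x : 'rV[R]_d => x *m M + c.

Lemma affine_conv M c u v (t : R) :
  affine M c (t *: u + (1 - t) *: v) = t *: affine M c u + (1 - t) *: affine M c v.
Proof.
rewrite /affine mulmxDl -!scalemxAl.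
move: (u *m M) (v *m M) => u' v'; apply/rowP => k; rewrite !mxE; ring.
Qed.

Lemma affine_quad_region M c A B C D :
  affine M c @` quad_region A B C D =
  quad_region (affine M c A) (affine M c B) (affine M c C) (affine M c D).
Proof.
set f := affine M c; apply/seteqP; split.
  move=> _ [x + <-]; move: x; apply: smallest_sub.
    apply/convex_setP => u v t t01 Hu Hv; rewrite /f affine_conv.
    by move=> S [cS HS]; apply: ((convex_setP S).1 cS) => //; [apply: Hu | apply: Hv].
  move=> x HX; apply: sub_gen_smallest.
  by move: HX => [[[->|->]|->]|->]; [do 3 left | do 2 left; right | left; right | right].
apply: smallest_sub.
  apply/convex_setP => _ _ t t01 [u Hu <-] [v Hv <-].
  exists (t *: u + (1 - t) *: v); last by rewrite /f affine_conv.
  by move=> S [cS HS]; apply: ((convex_setP S).1 cS) => //; [apply: Hu | apply: Hv].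
move=> x [[[->|->]|->]|->]; [exists A|exists B|exists C|exists D] => //;
  apply: sub_gen_smallest; [do 3 left | do 2 left; right | left; right | right] => //.
Qed.

Definition barycenter A B C D (l1 l2 l3 l4 : R) : 'rV[R]_d :=
  l1 *: A + l2 *: B + l3 *: C + l4 *: D.

Lemma quad_region_sub A B C D x : quad_region A B C D x ->
  exists l1 l2 l3 l4 : R, [/\ [/\ 0 <= l1, 0 <= l2, 0 <= l3 & 0 <= l4],
    l1 + l2 + l3 + l4 = 1 & x = barycenter A B C D l1 l2 l3 l4].
Proof.
move: x; apply: smallest_sub.
  apply/convex_setP => _ _ t /andP[t0 t1]
    [l1 [l2 [l3 [l4 [[p1 p2 p3 p4] l ->]]]]]
    [m1 [m2 [m3 [m4 [[q1 q2 q3 q4] m ->]]]]].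
  exists (t * l1 + (1 - t) * m1), (t * l2 + (1 - t) * m2),
     (t * l3 + (1 - t) * m3), (t * l4 + (1 - t) * m4).
  have t1' : 0 <= 1 - t by rewrite subr_ge0.
  split; first by split; rewrite addr_ge0 ?mulr_ge0.
    transitivity (t * (l1 + l2 + l3 + l4) + (1 - t) * (m1 + m2 + m3 + m4)).
      by ring.
    by rewrite l m; ring.
  by rewrite /barycenter; apply/rowP => k; rewrite !mxE; ring.
by move=> x [[[->|->]|->]|->]; [exists 1, 0, 0, 0 | exists 0, 1, 0, 0
   | exists 0, 0, 1, 0 | exists 0, 0, 0, 1]; (split; first by split); try ring;
  rewrite /barycenter !scale0r scale1r ?addr0 ?add0r.
Qed.

Lemma affine_barycenter M c A B C D l1 l2 l3 l4 : l1 + l2 + l3 + l4 = 1 ->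
  affine M c (barycenter A B C D l1 l2 l3 l4) =
  barycenter (affine M c A) (affine M c B) (affine M c C) (affine M c D) l1 l2 l3 l4.
Proof.
move=> l; have -> : l4 = 1 - l1 - l2 - l3 by rewrite -l; ring.
rewrite /affine /barycenter !mulmxDl -!scalemxAl.
move: (A *m M) (B *m M) (C *m M) (D *m M) => A' B' C' D'.
by apply/rowP => k; rewrite !mxE; ring.
Qed.

Lemma quad_regionC A B C D : quad_region A B C D C.
Proof. by apply: sub_gen_smallest; left; right. Qed.

Lemma quad_regionD A B C D : quad_region A B C D D.
Proof. by apply: sub_gen_smallest; right. Qed.

(* [s] is the largest value of a coordinate on the hull, attained only at the
   vertex whose weight in the two averaged points is [c3] and [e3]; [- t] is the
   value at the opposite vertex. *)
Lemma extreme_weight (t s m1 m3 m4 c1 c3 e1 e3 : R) :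
  0 < t -> 0 < s -> 0 <= m1 -> 0 <= m3 -> 0 <= m4 -> m3 + m4 <= 1 ->
  0 <= c1 -> c3 <= 1 -> 0 <= e1 -> e3 <= 1 ->
  s = - t * m1 + m3 * (- t * c1 + s * c3) + m4 * (- t * e1 + s * e3) ->
  c3 = 1 \/ e3 = 1.
Proof.
move=> t0 s0 m10 m30 m40 m34 c10 c31 e10 e31 E.
have [->|/eqP c3n] := eqVneq c3 1; first by left.
right; apply/eqP; apply/negP => /negP e3n.
have c3l : c3 < 1 by rewrite lt_neqAle c31 andbT; apply/eqP.
have e3l : e3 < 1 by rewrite lt_neqAle e3n e31.
have h1 : 0 <= m3 * (s * (1 - c3)).
  by rewrite !mulr_ge0 // ?subr_ge0 // ltW.
have h2 : 0 <= m4 * (s * (1 - e3)).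
  by rewrite !mulr_ge0 // ?subr_ge0 // ltW.
have h3 : 0 <= t * m1 by rewrite mulr_ge0 // ltW.
have h4 : 0 <= m3 * (t * c1) by rewrite !mulr_ge0 // ltW.
have h5 : 0 <= m4 * (t * e1) by rewrite !mulr_ge0 // ltW.
have h6 : 0 <= s * (1 - (m3 + m4)) by rewrite mulr_ge0 ?subr_ge0 // ltW.
have z1 : m3 * (s * (1 - c3)) = 0 by lra.
have z2 : m4 * (s * (1 - e3)) = 0 by lra.
have z6 : s * (1 - (m3 + m4)) = 0 by lra.
move/eqP: z1; rewrite !mulf_eq0 (gt_eqF s0) (gt_eqF (_ : 0 < 1 - c3)) ?subr_gt0 //.
rewrite !orbF => /eqP m30'.
move/eqP: z2; rewrite !mulf_eq0 (gt_eqF s0) (gt_eqF (_ : 0 < 1 - e3)) ?subr_gt0 //.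
rewrite !orbF => /eqP m40'.
move/eqP: z6; rewrite m30' m40' addr0 subr0 mulr1.
by rewrite (gt_eqF s0).
Qed.

Lemma weight_le1 (x y z w : R) : 0 <= x -> 0 <= y -> 0 <= z -> 0 <= w ->
  x + y + z + w = 1 -> [/\ z <= 1, w <= 1 & z + w <= 1].
Proof. by move=> *; split; lra. Qed.

Lemma weight_eq0 (x y z : R) : 0 <= x -> 0 <= y -> 0 <= z ->
  x + y + z + 1 = 1 -> [/\ x = 0, y = 0 & z = 0].
Proof. by move=> *; split; lra. Qed.

(** The map is only known to send hull onto hull, so the vertices have to be recovered. [C'] and
    [D'] are the unique maxima, on the second hull, of the coordinates along its diagonals; hence
    each is the image of [C] or [D]. An affine map preserves the parameters of the crossing point of
    the diagonals, which excludes an exchange and otherwise equates the shapes. *)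
Lemma affine_symmetric_shape A B C D C' D' a b a' b' :
  shape A B C D a b -> shape A B C' D' a' b' ->
  affine_symmetric A B C D C' D' <-> a = a' /\ b = b'.
Proof.
move=> H H'; have [a0 b0 fr E] := H; have [a'0 b'0 fr' E'] := H'.
have [an bn abn ab1n] := shape_neq0 a0 b0.
have [a'n b'n a'bn a'b1n] := shape_neq0 a'0 b'0.
split=> [[M [c /= [fseg fimg]]]|[aa bb]]; last first.
  (* The pseudo-inverse extends to the whole space the linear map that is prescribed on the two
     independent diagonals. *)
  pose M := pinvmx (col_mx (C - A) (D - B)) *m col_mx (C' - A) (D' - B).
  have : col_mx (C - A) (D - B) *m M = col_mx (C' - A) (D' - B).
    by rewrite mulmxA mulmxVp ?mul1mx //; apply/free2P.
  rewrite mul_col_mx => /eq_col_mx[MC MD].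
  pose f := affine M (A - A *m M).
  have fA : f A = A by rewrite /f /affine addrC subrK.
  have fE x y : f x = f y + (x - y) *m M.
    by rewrite /f /affine mulmxBl; move: (x *m M) (y *m M) (A *m M) => *;
       apply/rowP => k; rewrite !mxE; ring.
  have fC : f C = C' by rewrite (fE C A) fA MC addrC subrK.
  have fB : f B = B.
    rewrite (fE B A) fA E mulmxBl -!scalemxAl MC MD aa bb -E'.
    by rewrite addrC subrK.
  have fD : f D = D' by rewrite (fE D B) fB MD addrC subrK.
  exists M, (A - A *m M) => /=; split; last first.
    by have := affine_quad_region M (A - A *m M) A B C D; rewrite -/f fA fB fC fD.
  move=> x [t _ <-]; rewrite -[LHS]/(f _).
  have -> : (1 - t) *: A + t *: B = t *: B + (1 - t) *: A by rewrite addrC.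
  by rewrite /f affine_conv -/f fA fB.
pose f := affine M c.
have fA : f A = A by apply: fseg; apply/segP; exists 0; rewrite ?lexx ?ler01 // scale0r addr0.
have fB : f B = B.
  by apply: fseg; apply/segP; exists 1; rewrite ?lexx ?ler01 // scale1r addrC subrK.
have {}fimg : f @` quad_region A B C D = quad_region A B C' D' by [].
have [c1 [c2 [c3 [c4 [[c10 c20 c30 c40] cs fC]]]]] : exists l1 l2 l3 l4 : R,
    [/\ [/\ 0 <= l1, 0 <= l2, 0 <= l3 & 0 <= l4], l1 + l2 + l3 + l4 = 1 &
      f C = barycenter A B C' D' l1 l2 l3 l4].
  by apply: quad_region_sub; rewrite -fimg; exists C => //; apply: quad_regionC.
have [e1 [e2 [e3 [e4 [[e10 e20 e30 e40] es fD]]]]] : exists l1 l2 l3 l4 : R,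
    [/\ [/\ 0 <= l1, 0 <= l2, 0 <= l3 & 0 <= l4], l1 + l2 + l3 + l4 = 1 &
      f D = barycenter A B C' D' l1 l2 l3 l4].
  by apply: quad_region_sub; rewrite -fimg; exists D => //; apply: quad_regionD.
have pre y : quad_region A B C' D' y -> exists l1 l2 l3 l4 : R,
    [/\ [/\ 0 <= l1, 0 <= l2, 0 <= l3 & 0 <= l4], l1 + l2 + l3 + l4 = 1 &
      y = barycenter A B (f C) (f D) l1 l2 l3 l4].
  rewrite -fimg => -[x /quad_region_sub [l1 [l2 [l3 [l4 [l0 ls ->]]]]] <-].
  exists l1, l2, l3, l4; split => //.
  by rewrite /f affine_barycenter // -/f fA fB.
have [m1 [m2 [m3 [m4 [[m10 m20 m30 m40] ms CE']]]]] := pre _ (@quad_regionC A B C' D').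
have [n1 [n2 [n3 [n4 [[n10 n20 n30 n40] ns DE']]]]] := pre _ (@quad_regionD A B C' D').
have [F [G [frFG BE CE DE]]] := shape_frame H'.
pose t := b' / (a' + b'); pose s := (1 + a' * b')^-1.
have sE : a' * b' / (1 + a' * b') = 1 - s by rewrite /s; field.
have t0 : 0 < t by rewrite divr_gt0 ?addr_gt0.
have s0 : 0 < s by rewrite invr_gt0 addr_gt0 ?mulr_gt0.
have s1 : 0 < 1 - s by rewrite -sE divr_gt0 ?addr_gt0 ?mulr_gt0.
have t1 : 0 < 1 - t.
  have -> : 1 - t = a' / (a' + b') by rewrite /t; field.
  by rewrite divr_gt0 ?addr_gt0.
rewrite -/t -/s in BE; rewrite sE -/t in DE.
(* The origin is the crossing point of the diagonals of the second face, so its four vertices lie on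
   the axes. *)
have coord l1 l2 l3 l4 : l1 + l2 + l3 + l4 = 1 ->
  barycenter A B C' D' l1 l2 l3 l4 = A + t *: F +
    ((- t * l1 + (1 - t) * l3) *: F + (- s * l2 + (1 - s) * l4) *: G).
  move=> ls; have l1E : l1 = 1 - l2 - l3 - l4 by rewrite -ls; ring.
  by rewrite /barycenter BE CE DE l1E; apply/rowP => k; rewrite !mxE; ring.
have c2E : c2 = 1 - c1 - c3 - c4 by rewrite -cs; ring.
have e2E : e2 = 1 - e1 - e3 - e4 by rewrite -es; ring.
have comb l1 l2 l3 l4 y : l1 + l2 + l3 + l4 = 1 ->
  y = barycenter A B (f C) (f D) l1 l2 l3 l4 -> y = A + t *: F +
    ((- t * l1 + l3 * (- t * c1 + (1 - t) * c3) + l4 * (- t * e1 + (1 - t) * e3)) *: F +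
     (- s * l2 + l3 * (- s * c2 + (1 - s) * c4) + l4 * (- s * e2 + (1 - s) * e4)) *: G).
  move=> ls ->; have l1E : l1 = 1 - l2 - l3 - l4 by rewrite -ls; ring.
  rewrite fC fD !coord // /barycenter BE l1E; apply/rowP => k; rewrite !mxE; ring.
have [xC _] : 1 - t = - t * m1 + m3 * (- t * c1 + (1 - t) * c3)
     + m4 * (- t * e1 + (1 - t) * e3) /\
   0 = - s * m2 + m3 * (- s * c2 + (1 - s) * c4) + m4 * (- s * e2 + (1 - s) * e4).
  apply: (free2_eq frFG); apply: (addrI (A + t *: F)); rewrite -(comb _ _ _ _ _ ms CE') CE.
  by apply/rowP => k; rewrite !mxE; ring.
have [_ yD] : 0 = - t * n1 + n3 * (- t * c1 + (1 - t) * c3)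
     + n4 * (- t * e1 + (1 - t) * e3) /\
   1 - s = - s * n2 + n3 * (- s * c2 + (1 - s) * c4) + n4 * (- s * e2 + (1 - s) * e4).
  apply: (free2_eq frFG); apply: (addrI (A + t *: F)); rewrite -(comb _ _ _ _ _ ns DE') DE.
  by apply/rowP => k; rewrite !mxE; ring.
have [c31 c41 c341] := weight_le1 c10 c20 c30 c40 cs.
have [e31 e41 e341] := weight_le1 e10 e20 e30 e40 es.
have [_ _ m341] := weight_le1 m10 m20 m30 m40 ms.
have [_ _ n341] := weight_le1 n10 n20 n30 n40 ns.
have xx := extreme_weight t0 t1 m10 m30 m40 m341 c10 c31 e10 e31 xC.
have yy := extreme_weight s0 s1 n20 n30 n40 n341 c20 c41 e20 e41 yD.
have one (x : R) : 1 + x <= 1 -> x != 1.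
  by rewrite gerDl => x0; rewrite lt_eqF // (le_lt_trans x0).
have t00 : 0 < b / (a + b) by rewrite divr_gt0 ?addr_gt0.
have t10 : 0 < 1 - b / (a + b).
  have -> : 1 - b / (a + b) = a / (a + b) by field.
  by rewrite divr_gt0 ?addr_gt0.
have s00 : 0 < (1 + a * b)^-1 by rewrite invr_gt0 addr_gt0 ?mulr_gt0.
have fE x y : (x - y) *m M = f x - f y.
  by rewrite /f /affine mulmxBl opprD addrACA subrr addr0.
have fQ : B - A = (b / (a + b)) *: (f C - A) - (1 + a * b)^-1 *: (f D - B).
  have := congr1 (mulmx^~ M) E; rewrite /= [in RHS]mulmxBl -!scalemxAl !fE fA fB.
  by [].
have {c31 e31 c41 e41} [[c31 e41]|[e31 c41]] : (c3 = 1 /\ e4 = 1) \/ (e3 = 1 /\ c4 = 1).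
  case: xx yy => [c3E|e3E] [c4E|e4E]; [exfalso | by left | by right | exfalso].
    by move: c341; rewrite c3E => /one; rewrite c4E eqxx.
  by move: e341; rewrite e3E => /one; rewrite e4E eqxx.
  have fCE : f C = C'.
    have [|c10' c20' c40'] := weight_eq0 c10 c20 c40.
      by rewrite -[RHS]cs c31 addrAC.
    by rewrite fC /barycenter c31 c10' c20' c40' !scale0r scale1r addr0 !add0r.
  have fDE : f D = D'.
    have [|e10' e20' e30'] := weight_eq0 e10 e20 e30; first by rewrite -[RHS]es e41.
    by rewrite fD /barycenter e41 e10' e20' e30' !scale0r scale1r !add0r.
  rewrite fCE fDE in fQ.
  have [u1 u2] : b / (a + b) = b' / (a' + b') /\ - (1 + a * b)^-1 = - (1 + a' * b')^-1.
    by apply: (free2_eq fr'); rewrite !scaleNr -fQ -E'.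
  have u2' : a * b = a' * b' by move/oppr_inj/invr_inj: u2 => /addrI.
  have u1' : a * b' = a' * b.
    move: u1 => /(congr1 (fun x => x * (a + b) * (a' + b'))).
    rewrite mulfVK // mulrAC mulfVK // => u1.
    transitivity (b' * (a + b) - b * b'); first by ring.
    by rewrite -u1; ring.
  have aa : a = a'.
    apply/eqP; rewrite -(@eqrXn2 _ 2) ?ltW //; apply/eqP.
    apply: (mulIf (mulf_neq0 bn b'n)).
    transitivity ((a * b) * (a * b')); first by ring.
    by rewrite u2' u1'; ring.
  by split => //; apply: (mulfI an); rewrite u2' aa.
(* An exchange would map the diagonals to the opposite sides [AD'] and [BC'], which do not meet. *)
exfalso.
have fCE : f C = D'.
  have [|c10' c20' c30'] := weight_eq0 c10 c20 c30; first by rewrite -[RHS]cs c41.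
  by rewrite fC /barycenter c41 c10' c20' c30' !scale0r scale1r !add0r.
have fDE : f D = C'.
  have [|e10' e20' e40'] := weight_eq0 e10 e20 e40.
    by rewrite -[RHS]es e31 addrAC.
  by rewrite fD /barycenter e31 e10' e20' e40' !scale0r scale1r addr0 !add0r.
rewrite fCE fDE in fQ.
have [u _] : t = b / (a + b) * t - (1 + a * b)^-1 * (1 - t) /\
    - s = b / (a + b) * (1 - s) - (1 + a * b)^-1 * s.
  apply: (free2_eq frFG); transitivity (B - A).
    by rewrite BE; apply/rowP => k; rewrite !mxE; ring.
  by rewrite fQ DE CE BE; apply/rowP => k; rewrite !mxE; ring.
have : 0 < (1 - b / (a + b)) * t + (1 + a * b)^-1 * (1 - t).
  by rewrite addr_gt0 // mulr_gt0.
have -> : (1 - b / (a + b)) * t + (1 + a * b)^-1 * (1 - t) =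
  t - (b / (a + b) * t - (1 + a * b)^-1 * (1 - t)) by ring.
by rewrite -u subrr ltxx.
Qed.

End AffineSymmetry.

(** * From times to nets and back *)

Definition shape_net (R : realType) (d m n : nat) (P : grid R d m n)
    (a b : nat -> nat -> R) : Prop :=
  forall i j, (i < m)%N -> (j < n)%N ->
    shape (pt P i j) (pt P i.+1 j) (pt P i.+1 j.+1) (pt P i j.+1) (a i j) (b i j).

Section Conditions.
Variables (R : realType) (d m n : nat).
Variables (P : grid R d m n) (a b : nat -> nat -> R).
Hypothesis shP : shape_net P a b.

Lemma pt_subnet k l p q i j : (i <= k)%N -> (j <= l)%N ->
  pt (subnet k l p q P) i j = pt P (p + i) (q + j).
Proof. by move=> hi hj; rewrite {1}/pt /subnet !inordK. Qed.

Lemma faces12_subnet S p q : faces12 S (subnet 1 2 p q P) =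
  S (pt P p q.+1) (pt P p.+1 q.+1) (pt P p.+1 q) (pt P p q) (pt P p.+1 q.+2)
    (pt P p q.+2).
Proof. by rewrite /faces12 !pt_subnet // !addn0 !addn1 addn2. Qed.

Lemma faces21_subnet S p q : faces21 S (subnet 2 1 p q P) =
  S (pt P p.+1 q) (pt P p.+1 q.+1) (pt P p q.+1) (pt P p q) (pt P p.+2 q.+1)
    (pt P p.+2 q).
Proof. by rewrite /faces21 !pt_subnet // !addn0 !addn1 addn2. Qed.

Lemma each_subnet12P S : each_subnet12 (faces12 S) P <->
  forall i j, (i < m)%N -> (j.+1 < n)%N ->
    S (pt P i j.+1) (pt P i.+1 j.+1) (pt P i.+1 j) (pt P i j) (pt P i.+1 j.+2)
      (pt P i j.+2).
Proof.
by split=> H p q; have := H p q; rewrite addn1 addn2 faces12_subnet.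
Qed.

Lemma each_subnet21P S : each_subnet21 (faces21 S) P <->
  forall i j, (i.+1 < m)%N -> (j < n)%N ->
    S (pt P i.+1 j) (pt P i.+1 j.+1) (pt P i j.+1) (pt P i j) (pt P i.+2 j.+1)
      (pt P i.+2 j).
Proof.
by split=> H p q; have := H p q; rewrite addn1 addn2 faces21_subnet.
Qed.

Lemma affine12P : each_subnet12 (faces12 (@affine_symmetric R d)) P <->
  forall i j, (i < m)%N -> (j.+1 < n)%N ->
    (a i j)^-1 = a i j.+1 /\ b i j = b i j.+1.
Proof.
rewrite each_subnet12P; split=> H i j hi hj.
  exact/(affine_symmetric_shape (shape_DCBA (shP hi (ltnW hj))) (shP hi hj))/H.
exact/(affine_symmetric_shape (shape_DCBA (shP hi (ltnW hj))) (shP hi hj))/H.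
Qed.

Lemma affine21P : each_subnet21 (faces21 (@affine_symmetric R d)) P <->
  forall i j, (i.+1 < m)%N -> (j < n)%N ->
    b i j = (b i.+1 j)^-1 /\ a i j = a i.+1 j.
Proof.
rewrite each_subnet21P; split=> H i j hi hj.
  have := H i j hi hj.
  move/(affine_symmetric_shape (shape_BCDA (shP (ltnW hi) hj)) (shape_ADCB (shP hi hj))).
  by move=> [-> /invr_inj ->].
apply/(affine_symmetric_shape (shape_BCDA (shP (ltnW hi) hj)) (shape_ADCB (shP hi hj))).
by have [-> ->] := H i j hi hj.
Qed.

Lemma equal_opposite_ratios_shape A B C D C' D' (x y x' y' : R) :
  shape A B C D x y -> shape A B C' D' x' y' ->
  @equal_opposite_ratios R d A B C D C' D' <-> x = x'.
Proof.
move=> H H'; have [x0 _ _ _] := H; have [x'0 _ _ _] := H'.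
rewrite /equal_opposite_ratios (opposite_ratio_shape H) (opposite_ratio_shape H').
split=> [/invr_inj E|->//]; apply/eqP.
by rewrite -(@eqrXn2 _ 2) ?ltW // E.
Qed.

Lemma ratios12P : each_subnet12 (faces12 (@equal_opposite_ratios R d)) P <->
  forall i j, (i < m)%N -> (j.+1 < n)%N -> (a i j)^-1 = a i j.+1.
Proof.
rewrite each_subnet12P; split=> H i j hi hj.
  exact/(equal_opposite_ratios_shape (shape_DCBA (shP hi (ltnW hj))) (shP hi hj))/H.
exact/(equal_opposite_ratios_shape (shape_DCBA (shP hi (ltnW hj))) (shP hi hj))/H.
Qed.

Lemma ratios21P : each_subnet21 (faces21 (@equal_opposite_ratios R d)) P <->
  forall i j, (i.+1 < m)%N -> (j < n)%N -> b i j = (b i.+1 j)^-1.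
Proof.
rewrite each_subnet21P; split=> H i j hi hj.
  exact/(equal_opposite_ratios_shape (shape_BCDA (shP (ltnW hi) hj))
    (shape_ADCB (shP hi hj)))/H.
exact/(equal_opposite_ratios_shape (shape_BCDA (shP (ltnW hi) hj))
    (shape_ADCB (shP hi hj)))/H.
Qed.

End Conditions.

(** * Nets built from compatible times *)

Section Realize.
Variables (R : realType) (d m n : nat).
Variables (P : grid R d m n) (a b : nat -> nat -> R).
Hypothesis shP : shape_net P a b.
Implicit Type X : nat -> nat -> R.

(* Scale factor of the edge from the point [(i, j)] to the point [(i + 1, j)];
   the boundary edge [j = n] only belongs to the face below it. *)
Definition scaleU X i j : R :=
  if (j < n)%N then sc (a i j) (X i j) else sc (a i j.-1)^-1 (X i j.-1).

Definition scaleV X i j : R :=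
  if (i < m)%N then sc (b i j)^-1 (X i j)^-1 else sc (b i.-1 j) (X i.-1 j)^-1.

Lemma scaleU_bottom X i j : (j < n)%N -> scaleU X i j = sc (a i j) (X i j).
Proof. by rewrite /scaleU => ->. Qed.

Lemma scaleU_top X i j : compatible m n a b X -> (i < m)%N -> (j < n)%N ->
  scaleU X i j.+1 = sc (a i j)^-1 (X i j).
Proof.
move=> [cU _] hi hj; rewrite /scaleU; case: ifP => // hj'.
by rewrite cU.
Qed.

Lemma scaleV_left X i j : (i < m)%N -> scaleV X i j = sc (b i j)^-1 (X i j)^-1.
Proof. by rewrite /scaleV => ->. Qed.

Lemma scaleV_right X i j : compatible m n a b X -> (i < m)%N -> (j < n)%N ->
  scaleV X i.+1 j = sc (b i j) (X i j)^-1.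
Proof.
move=> [_ cV] hi hj; rewrite /scaleV; case: ifP => // hi'.
by rewrite cV.
Qed.

(** The scaled edges are summed along the bottom line and then upwards. The edges in direction [j]
    are thus right by construction; those in direction [i] follow by induction on [j], because each
    scaled face closes up. *)
Definition net_of X i j : 'rV[R]_d :=
  pt P 0 0 + \sum_(0 <= k < i) scaleU X k 0 *: (pt P k.+1 0 - pt P k 0)
  + \sum_(0 <= l < j) scaleV X i l *: (pt P i l.+1 - pt P i l).

Lemma net_ofV X i j :
  net_of X i j.+1 - net_of X i j = scaleV X i j *: (pt P i j.+1 - pt P i j).
Proof. by rewrite /net_of big_nat_recr //= addrA [X in X - _]addrC addrK. Qed.

Lemma sc_closed A B C D (x y z : R) : z != 0 -> @shape R d A B C D x y ->
  sc x z *: (B - A) + sc y z^-1 *: (C - B) + sc x^-1 z *: (D - C)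
  + sc y^-1 z^-1 *: (A - D) = 0.
Proof.
move=> z0 H; have [x0 y0 _ _] := H; have [xn yn xyn xy1n] := shape_neq0 x0 y0.
have [F [G [fr BE CE DE]]] := shape_frame H; subst.
by apply/rowP => k; rewrite !mxE /sc; field; rewrite ?xn ?yn ?xyn ?xy1n ?z0.
Qed.

Lemma net_ofU X i j : (forall i j, (i < m)%N -> (j < n)%N -> 0 < X i j) ->
  compatible m n a b X -> (i < m)%N -> (j <= n)%N ->
  net_of X i.+1 j - net_of X i j = scaleU X i j *: (pt P i.+1 j - pt P i j).
Proof.
move=> X0 cX hi; elim: j => [_|j IH hj].
  by rewrite /net_of !big_nil !addr0 big_nat_recr //= addrA [X in X - _]addrC addrK.
have -> : net_of X i.+1 j.+1 - net_of X i j.+1 = (net_of X i.+1 j - net_of X i j)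
    + (net_of X i.+1 j.+1 - net_of X i.+1 j) - (net_of X i j.+1 - net_of X i j).
  by apply/rowP => k; rewrite !mxE; ring.
rewrite IH ?(ltnW hj) // !net_ofV (scaleU_bottom X i hj) (scaleU_top cX hi hj).
rewrite (scaleV_left X j hi) (scaleV_right cX hi hj).
have := sc_closed (lt0r_neq0 (X0 i j hi hj)) (shP hi hj).
move: (sc _ _) (sc _ _) (sc _ _) (sc _ _) => p q r s E.
apply: (addIr (r *: (pt P i j.+1 - pt P i.+1 j.+1))).
apply/eqP; rewrite -subr_eq0 -E; apply/eqP.
rewrite E; apply/rowP => k; move/rowP/(_ k): E; rewrite !mxE => E; lra.
Qed.

Lemma net_of1 X i j : (forall i j, (i < m)%N -> (j < n)%N -> X i j = 1) ->
  (i <= m)%N -> (j <= n)%N -> (0 < m)%N -> (0 < n)%N -> net_of X i j = pt P i j.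
Proof.
move=> X1 hi hj m0 n0; rewrite /net_of.
have pm k : (0 < k <= m)%N -> (k.-1 < m)%N by move=> /andP[]; case: k.
have pn k : (0 < k <= n)%N -> (k.-1 < n)%N by move=> /andP[]; case: k.
rewrite (@eq_big_nat _ _ _ 0 i _ (fun k => pt P k.+1 0 - pt P k 0)); last first.
  move=> k /andP[_ ki]; rewrite scaleU_bottom // X1 ?(leq_trans ki) //.
  by rewrite sc1 scale1r.
rewrite telescope_sumr // [pt P 0 0 + _]addrC subrK.
rewrite (@eq_big_nat _ _ _ 0 j _ (fun l => pt P i l.+1 - pt P i l)); last first.
  move=> l /andP[_ lj]; have ln := leq_trans lj hj; rewrite /scaleV.
  case: ifP => im; first by rewrite X1 // invr1 sc1 scale1r.
  have i0 : (0 < i)%N by move/negbT: im; rewrite -leqNgt; apply: leq_trans.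
  by rewrite X1 ?pm ?i0 // invr1 sc1 scale1r.
by rewrite telescope_sumr // addrC subrK.
Qed.

Definition net_grid X : grid R d m n := fun i j => net_of X i j.

Lemma pt_net_grid X i j : (i <= m)%N -> (j <= n)%N ->
  pt (net_grid X) i j = net_of X i j.
Proof. by move=> hi hj; rewrite /pt /net_grid !inordK. Qed.

Definition positive_scales X i j : Prop :=
  [/\ 0 < X i j, 0 < sc (a i j) (X i j), 0 < sc (b i j) (X i j)^-1,
      0 < sc (a i j)^-1 (X i j) & 0 < sc (b i j)^-1 (X i j)^-1].

Lemma net_grid_face X i j :
  (forall i j, (i < m)%N -> (j < n)%N -> positive_scales X i j) ->
  compatible m n a b X -> (i < m)%N -> (j < n)%N ->
  convex_quad (pt (net_grid X) i j) (pt (net_grid X) i.+1 j)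
    (pt (net_grid X) i.+1 j.+1) (pt (net_grid X) i j.+1) /\
  face_area (net_grid X) i j = face_area P i j.
Proof.
move=> pX cX hi hj; have [X0 ? ? ? ?] := pX i j hi hj.
have X0' k l : (k < m)%N -> (l < n)%N -> 0 < X k l.
  by move=> hk hl; have [] := pX k l hk hl.
rewrite /face_area !pt_net_grid ?(ltnW hi) ?(ltnW hj) //.
apply: (scaled_face_convex (shP hi hj) X0) => //; split.
- by rewrite net_ofU ?(ltnW hj) // scaleU_bottom.
- by rewrite net_ofV (scaleV_right cX hi hj).
- rewrite -[LHS]opprB net_ofU // (scaleU_top cX hi hj).
  by rewrite -scalerN opprB.
- rewrite -[LHS]opprB net_ofV (scaleV_left X j hi).
  by rewrite -scalerN opprB.
Qed.

Lemma net_grid_parallel X Y :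
  (forall i j, (i < m)%N -> (j < n)%N -> 0 < X i j) -> compatible m n a b X ->
  (forall i j, (i < m)%N -> (j < n)%N -> 0 < Y i j) -> compatible m n a b Y ->
  parallel_nets (net_grid X) (net_grid Y).
Proof.
move=> X0 cX Y0 cY; split=> i j hi hj.
  rewrite !pt_net_grid ?(ltnW hi) // !net_ofU //; exact: scale_parallel.
by rewrite !pt_net_grid ?(ltnW hj) // !net_ofV; exact: scale_parallel.
Qed.

Lemma edist_scale (A B A' B' : 'rV[R]_d) (k : R) : 0 < k ->
  B' - A' = k *: (B - A) -> Defs.edist B' A' = k * Defs.edist B A.
Proof.
move=> k0; rewrite /Defs.edist => ->.
have -> : dot (k *: (B - A)) (k *: (B - A)) = k ^+ 2 * dot (B - A) (B - A).
  by rewrite /dot mulr_sumr; apply: eq_bigr => l _; rewrite !mxE; ring.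
by rewrite sqrtrM ?sqr_ge0 // sqrtr_sqr gtr0_norm.
Qed.

Lemma shape_edge_neq0 A B C D (x y : R) : @shape R d A B C D x y -> B - A != 0.
Proof.
move=> H; have [x0 y0 _ _] := H; have [F [G [fr BE _ _]]] := shape_frame H.
rewrite BE addrC addKr; apply/negP => /eqP /fr[/eqP].
by rewrite gt_eqF // divr_gt0 // addr_gt0.
Qed.

(** An isometry preserves the length of the first edge, and this already determines its scale. *)
Lemma net_grid_congruent X Y : (0 < m)%N -> (0 < n)%N ->
  (forall i j, (i < m)%N -> (j < n)%N -> positive_scales X i j) ->
  compatible m n a b X ->
  (forall i j, (i < m)%N -> (j < n)%N -> positive_scales Y i j) ->
  compatible m n a b Y ->
  congruent_nets (net_grid X) (net_grid Y) ->
  sc (a 0%N 0%N) (X 0%N 0%N) = sc (a 0%N 0%N) (Y 0%N 0%N).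
Proof.
move=> m0 n0 pX cX pY cY [f fi fE].
have X0' k l : (k < m)%N -> (l < n)%N -> 0 < X k l.
  by move=> hk hl; have [] := pX k l hk hl.
have Y0' k l : (k < m)%N -> (l < n)%N -> 0 < Y k l.
  by move=> hk hl; have [] := pY k l hk hl.
have [_ sX _ _ _] := pX 0%N 0%N m0 n0; have [_ sY _ _ _] := pY 0%N 0%N m0 n0.
have uX := net_ofU X0' cX m0 (leq0n n); have uY := net_ofU Y0' cY m0 (leq0n n).
rewrite scaleU_bottom // in uX; rewrite scaleU_bottom // in uY.
have fpt i j : pt (net_grid Y) i j = f (pt (net_grid X) i j) by rewrite /pt fE.
have := fi (pt (net_grid X) 1 0) (pt (net_grid X) 0 0).
rewrite -!fpt !pt_net_grid // (edist_scale sX uX) (edist_scale sY uY).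
move=> /esym; apply: mulIf; rewrite gt_eqF // sqrtr_gt0.
exact: dot_gt0 (shape_edge_neq0 (shP m0 n0)).
Qed.

Lemma continuous_sum (V : normedModType R) (t : R) k (f : nat -> R -> V) :
  (forall l, (l < k)%N -> {for t, continuous (f l)}) ->
  {for t, continuous (fun s => \sum_(0 <= l < k) f l s)}.
Proof.
elim: k => [|k IH] H.
  rewrite (_ : (fun s => _) = (fun _ => 0)); first exact: cvg_cst.
  by apply/funext => s; rewrite big_nil.
rewrite (_ : (fun s => _) = (fun s => \sum_(0 <= l < k) f l s + f k s)); last first.
  by apply/funext => s; rewrite big_nat_recr.
apply: (@continuousD _ _ _ (fun s => \sum_(0 <= l < k) f l s)); last exact: H.
by apply: IH => l lk; apply: H; apply: ltnW.
Qed.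

Lemma net_of_continuous (X : R -> nat -> nat -> R) (t : R) i j :
  (0 < m)%N -> (0 < n)%N ->
  (forall i j, (i < m)%N -> (j < n)%N ->
     0 < X t i j /\ {for t, continuous (fun s => X s i j)}) ->
  (i <= m)%N -> (j <= n)%N -> {for t, continuous (fun s => net_of (X s) i j)}.
Proof.
move=> m0 n0 H hi hj; rewrite /net_of.
have cV k l : (k < m)%N -> (l < n)%N -> {for t, continuous (fun s => (X s k l)^-1)}.
  move=> hk hl; have [X0 cX] := H k l hk hl; apply: continuous_invr cX.
  by rewrite lt0r_neq0.
apply: (@continuousD _ _ _ (fun s => pt P 0 0 + _)).
  apply: (@continuousD _ _ _ (fun _ => pt P 0 0)); first exact: cvg_cst.
  apply: continuous_sum => k ki; apply: continuousZr_tmp; rewrite /scaleU n0.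
  have [X0 cX] := H k 0%N (leq_trans ki hi) n0; exact: continuous_sc.
apply: continuous_sum => l lj; apply: continuousZr_tmp; rewrite /scaleV.
have ln := leq_trans lj hj; case: (boolP (i < m)%N) => im.
  have [X0 cX] := H i l im ln; apply: continuous_sc; last exact: cV.
  by rewrite invr_gt0.
have im' : (i.-1 < m)%N.
  by case: (i) hi => [|i'] /=.
have [X0 cX] := H i.-1 l im' ln; apply: continuous_sc; last exact: cV.
by rewrite invr_gt0.
Qed.

Lemma deformation_family_deformable (X : R -> nat -> nat -> R) :
  (0 < m)%N -> (0 < n)%N -> deformation_family m n a b X -> deformable P.
Proof.
move=> m0 n0 [gX cX iX].
have a0 : 0 < a 0%N 0%N by have [] := shP m0 n0.
have near_scales : \forall t \near (0 : R), forall i j, (i < m)%N -> (j < n)%N ->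
    positive_scales (X t) i j /\ {for t, continuous (fun s => X s i j)}.
  apply: (@near_all_ltn2 _ (nbhs (0 : R)) _ m n) => i j hi hj; have g := gX i j hi hj.
  have [_ g1] := g; have [_ g2] := unit_germ_sc (a i j) g.
  have [_ g3] := unit_germ_sc (b i j) (unit_germ_invr g).
  have [_ g4] := unit_germ_sc (a i j)^-1 g.
  have [_ g5] := unit_germ_sc (b i j)^-1 (unit_germ_invr g).
  near=> t.
  have [? ?] : 0 < X t i j /\ {for t, continuous (fun s => X s i j)} by near: t.
  split => //; split => //.
  - by have [] : 0 < sc (a i j) (X t i j) /\
      {for t, continuous (fun s => sc (a i j) (X s i j))} by near: t.
  - by have [] : 0 < sc (b i j) (X t i j)^-1 /\
      {for t, continuous (fun s => sc (b i j) (X s i j)^-1)} by near: t.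
  - by have [] : 0 < sc (a i j)^-1 (X t i j) /\
      {for t, continuous (fun s => sc (a i j)^-1 (X s i j))} by near: t.
  - by have [] : 0 < sc (b i j)^-1 (X t i j)^-1 /\
      {for t, continuous (fun s => sc (b i j)^-1 (X s i j)^-1)} by near: t.
(* This bound is the one of [sc_inj] for the first edge, whose scale will distinguish the members of
   the family. *)
have near1 : \forall t \near (0 : R), 1 - a 0%N 0%N / 2 < X t 0%N 0%N.
  by apply: unit_germ_near; [exact: gX | rewrite gtrDl oppr_lt0 divr_gt0].
have [e /= e0 He] : exists2 e : R, 0 < e & forall t, `|t| < e ->
    [/\ forall i j, (i < m)%N -> (j < n)%N ->
        positive_scales (X t) i j /\ {for t, continuous (fun s => X s i j)},
      1 - a 0%N 0%N / 2 < X t 0%N 0%N & compatible m n a b (X t)].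
  have [e /= e0 He] : \forall t \near (0 : R),
    [/\ forall i j, (i < m)%N -> (j < n)%N ->
        positive_scales (X t) i j /\ {for t, continuous (fun s => X s i j)},
      1 - a 0%N 0%N / 2 < X t 0%N 0%N & compatible m n a b (X t)].
    by near=> t; split; near: t.
  exists e => // t te; apply: He; by rewrite /ball /= sub0r normrN.
(* The parameter interval is shrunk by [e / 2] so that its endpoint 1 stays inside the open ball;
   the given net sits at 0. *)
pose r (t : R) := e / 2 * t.
have re (t : R) : t \in `[0, 1] -> `|r t| < e.
  rewrite in_itv /= => /andP[t0 t1].
  have e2 : 0 < e / 2 by rewrite divr_gt0.
  rewrite /r ger0_norm; last by rewrite mulr_ge0 // ltW.
  apply: (@le_lt_trans _ _ (e / 2)); first by rewrite ler_piMr // ltW.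
  by rewrite ltr_pdivrMr // ltr_pMr // ltr1n.
exists (fun t => net_grid (X (r t))).
have pX t : t \in `[0, 1] -> forall i j, (i < m)%N -> (j < n)%N ->
    positive_scales (X (r t)) i j.
  by move=> /re /He[H _ _] i j hi hj; have [] := H i j hi hj.
have pX0 t : t \in `[0, 1] -> forall i j, (i < m)%N -> (j < n)%N -> 0 < X (r t) i j.
  by move=> ht i j hi hj; have [] := pX t ht i j hi hj.
have pc t : t \in `[0, 1] -> compatible m n a b (X (r t)).
  by move=> /re /He[_ _].
split.
- exists 0; first by rewrite in_itv /= lexx ler01.
  move=> i j; rewrite /net_grid net_of1 ?leq_ord //; first by rewrite /pt !inord_val.
  by move=> k l hk hl; rewrite /r mulr0; have [] := gX k l hk hl.
- move=> i j; apply: continuous_in_subspaceT => t /set_mem /= ht.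
  apply: (@continuous_comp _ _ _ r (fun s => net_of (X s) i j)).
    by apply: cvgMr; apply: cvg_id.
  apply: net_of_continuous; rewrite ?leq_ord // => k l hk hl.
  have [H _ _] := He _ (re _ ht); have [[? _ _ _ _] ?] := H k l hk hl.
  by [].
- move=> t ht i j hi hj; exact: (net_grid_face (pX t ht) (pc t ht) hi hj).1.
- move=> s t hs ht; split.
    exact: net_grid_parallel (pX0 s hs) (pc s hs) (pX0 t ht) (pc t ht).
  move=> i j hi hj; rewrite (net_grid_face (pX s hs) (pc s hs) hi hj).2.
  by rewrite (net_grid_face (pX t ht) (pc t ht) hi hj).2.
- move=> s t hs ht st.
  move/(net_grid_congruent m0 n0 (pX s hs) (pc s hs) (pX t ht) (pc t ht)).
  have [_ s1 _] := He _ (re _ hs); have [_ t1 _] := He _ (re _ ht).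
  move/(sc_inj a0 (pX0 s hs _ _ m0 n0) (pX0 t ht _ _ m0 n0) s1 t1) => /iX.
  have e2 : e / 2 != 0 by rewrite lt0r_neq0 // divr_gt0.
  by rewrite /r => /(mulfI e2) E; rewrite E eqxx in st.
Unshelve. all: by end_near. Qed.

End Realize.

(** * Times extracted from a deformation *)

Definition edgeU (R : realType) (d m n : nat) (P : grid R d m n) i j :=
  pt P i.+1 j - pt P i j.
Definition edgeV (R : realType) (d m n : nat) (P : grid R d m n) i j :=
  pt P i j.+1 - pt P i j.

(** Projection coefficient of [u] on [v]: it is the scale factor when the vectors are parallel, and
    it is continuous in [u] in any case. *)
Definition ratio (R : realType) (d : nat) (v u : 'rV[R]_d) : R :=
  dot u v / dot v v.

Lemma ratio_scale (R : realType) (d : nat) (v : 'rV[R]_d) k :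
  v != 0 -> ratio v (k *: v) = k.
Proof.
move=> v0; rewrite /ratio.
have -> : dot (k *: v) v = k * dot v v.
  by rewrite /dot mulr_sumr; apply: eq_bigr => l _; rewrite mxE mulrA.
by rewrite mulfK // gt_eqF // dot_gt0.
Qed.

Lemma parallel_ratio (R : realType) (d : nat) (u v : 'rV[R]_d) :
  v != 0 -> parallel_vec v u -> u = ratio v u *: v.
Proof. by move=> v0 /(parallel_scale v0)[k ->]; rewrite ratio_scale. Qed.

Lemma ratio_cvg (R : realType) (d : nat) (T : Type) (F : set_system T)
    {FF : Filter F} (f : T -> 'rV[R]_d) (u v : 'rV[R]_d) :
  f @ F --> u -> ratio v (f t) @[t --> F] --> ratio v u.
Proof.
move=> fu; rewrite /ratio; apply: cvgMl; rewrite /dot.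
apply: cvg_big => [|k _]; first exact: add_continuous.
apply: cvgMl; apply: (@cvg_comp _ _ _ f (fun M : 'rV[R]_d => M 0 k)) fu _.
exact: coord_continuous.
Qed.

Section ShapeNet.
Variables (R : realType) (d m n : nat).
Variables (P : grid R d m n) (a b : nat -> nat -> R).
Hypotheses (m0 : (0 < m)%N) (n0 : (0 < n)%N) (shP : shape_net P a b).

Lemma edgeU_neq0 i j : (i < m)%N -> (j <= n)%N -> edgeU P i j != 0.
Proof.
move=> hi; case: j => [|j] hj; first exact: shape_edge_neq0 (shP hi n0).
exact: shape_edge_neq0 (shape_DCBA (shP hi hj)).
Qed.

Lemma edgeV_neq0 i j : (i <= m)%N -> (j < n)%N -> edgeV P i j != 0.
Proof.
move=> + hj; case: i => [|i] hi; first exact: shape_edge_neq0 (shape_ADCB (shP m0 hj)).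
exact: shape_edge_neq0 (shape_BCDA (shP hi hj)).
Qed.

Lemma congruent_translate (N N' : grid R d m n) :
  (forall i j, (i < m)%N -> (j <= n)%N -> edgeU N i j = edgeU N' i j) ->
  (forall i j, (i <= m)%N -> (j < n)%N -> edgeV N i j = edgeV N' i j) ->
  congruent_nets N N'.
Proof.
move=> HU HV; pose c := pt N' 0 0 - pt N 0 0.
exists (fun x => x + c).
  by move=> u v; rewrite /Defs.edist opprD addrACA subrr addr0.
have H i j : (i <= m)%N -> (j <= n)%N -> pt N' i j = pt N i j + c.
  move=> + hj; elim: i => [|i IH] hi.
    elim: j hj => [_|j IH hj]; first by rewrite addrC subrK.
    have := HV 0%N j (leq0n m) hj; rewrite /edgeV (IH (ltnW hj)) => E.
    by rewrite -[LHS](subrK (pt N 0 j + c)) -E addrA subrK.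
  have := HU i j hi hj; rewrite /edgeU (IH (ltnW hi)) => E.
  by rewrite -[LHS](subrK (pt N i j + c)) -E addrA subrK.
move=> i j; have := H i j (leq_ord i) (leq_ord j).
by rewrite /pt !inord_val.
Qed.

End ShapeNet.

(** A sequence that tends to [t0] from the direction of an endpoint [c] of the interval other than
    [t0] also covers the case where [t0] is itself an endpoint. *)
Lemma infinite_near_within (R : realType) (Q : R -> Prop) (t0 : R) :
  t0 \in `[0, 1] -> (\forall t \near within `[0, 1]%classic (nbhs t0), Q t) ->
  infinite_set [set t | t \in `[0, 1] /\ Q t].
Proof.
rewrite in_itv /= => /andP[t00 t01] [e /= e0 He] fin.
have [c c01 ct] : exists2 c : R, 0 <= c <= 1 & c - t0 != 0.
  have [->|t0n] := eqVneq t0 0; first by exists 1; rewrite ?ler01 ?lexx // subr0 oner_eq0.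
  by exists 0; rewrite ?ler01 ?lexx // sub0r oppr_eq0.
have [c0 c1] := andP c01.
have e1 : 0 < 1 + e by rewrite addr_gt0.
(* The factor [e / (1 + e)] is below both 1 and [e], so the points stay in the interval and in the
   ball. *)
pose th (k : nat) : R := e / (1 + e) / k.+1%:R.
have th0 k : 0 < th k by rewrite !divr_gt0.
have th1 k : th k <= e / (1 + e).
  by rewrite ler_pdivrMr ?ltr0n // ler_pMr ?divr_gt0 // ler1n.
have thl k : th k < 1.
  by rewrite (le_lt_trans (th1 k)) // ltr_pdivrMr // mul1r ltrDr.
have the k : th k < e.
  by rewrite (le_lt_trans (th1 k)) // ltr_pdivrMr // ltr_pMr // ltrDl.
pose f k := t0 + th k * (c - t0).
have finj : {in [set: nat] &, injective f}.
  move=> k l _ _ /addrI /(mulIf ct).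
  have ee : e / (1 + e) != 0 by rewrite lt0r_neq0 // divr_gt0.
  by move=> /(mulfI ee) /invr_inj /eqP; rewrite eqr_nat => /eqP [].
apply: (infinite_image finj infinite_nat); apply: sub_finite_set fin.
move=> _ [k _ <-].
have fI : 0 <= f k <= 1.
  have -> : f k = (1 - th k) * t0 + th k * c by rewrite /f; ring.
  have h1 : 0 <= 1 - th k by rewrite subr_ge0 ltW.
  apply/andP; split.
    by apply: addr_ge0; apply: mulr_ge0 => //; apply: ltW (th0 k).
  have : (1 - th k) * t0 + th k * c <= (1 - th k) * 1 + th k * 1.
    by apply: lerD; apply: ler_wpM2l => //; apply: ltW (th0 k).
  by rewrite !mulr1 subrK.
split; first by rewrite in_itv.
apply: He; rewrite /= ?in_itv //.
have ctl : `|c - t0| <= 1 by rewrite ler_norml; apply/andP; split; lra.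
rewrite /f opprD addrA subrr sub0r normrN normrM gtr0_norm //.
by rewrite (le_lt_trans _ (the k)) // ler_piMr // ltW.
Qed.

Section Forward.
Variables (R : realType) (d m n : nat).
Variables (P : grid R d m n) (a b : nat -> nat -> R).
Hypotheses (m0 : (0 < m)%N) (n0 : (0 < n)%N) (shP : shape_net P a b).

Definition scU (N : grid R d m n) i j := ratio (edgeU P i j) (edgeU N i j).
Definition scV (N : grid R d m n) i j := ratio (edgeV P i j) (edgeV N i j).

Definition face_param (N : grid R d m n) i j : R :=
  ((b i j + 1) * scU N i j + (a i j - 1) * scV N i.+1 j) / (a i j + b i j).

(* Closeness to [P] makes every [sc] occurring in the net injective. *)
Definition close_face (N : grid R d m n) i j : Prop :=
  [/\ [/\ 0 < scU N i j, 0 < scV N i.+1 j, 0 < scU N i j.+1 & 0 < scV N i j],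
      1 - a i j / 2 < face_param N i j, 1 - (a i j)^-1 / 2 < face_param N i j,
      1 - b i j / 2 < (face_param N i j)^-1 &
      1 - (b i j)^-1 / 2 < (face_param N i j)^-1].

Lemma scU_edge N i j : parallel_nets P N -> (i < m)%N -> (j <= n)%N ->
  edgeU N i j = scU N i j *: edgeU P i j.
Proof.
move=> [pU _] hi hj; apply: parallel_ratio; last exact: pU.
exact: (edgeU_neq0 n0 shP hi hj).
Qed.

Lemma scV_edge N i j : parallel_nets P N -> (i <= m)%N -> (j < n)%N ->
  edgeV N i j = scV N i j *: edgeV P i j.
Proof.
move=> [_ pV] hi hj; apply: parallel_ratio; last exact: pV.
exact: (edgeV_neq0 m0 shP hi hj).
Qed.

Lemma face_param_spec N i j : parallel_nets P N -> same_face_areas P N ->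
  close_face N i j -> (i < m)%N -> (j < n)%N ->
  [/\ 0 < face_param N i j, scU N i j = sc (a i j) (face_param N i j),
      scV N i.+1 j = sc (b i j) (face_param N i j)^-1,
      scU N i j.+1 = sc (a i j)^-1 (face_param N i j) &
      scV N i j = sc (b i j)^-1 (face_param N i j)^-1].
Proof.
move=> parN areaN [[u0 v0 u1 v1] _ _ _ _] hi hj.
have sh := shP hi hj; have [a0 b0 _ _] := sh.
have SF : scaled_face (pt P i j) (pt P i.+1 j) (pt P i.+1 j.+1) (pt P i j.+1)
    (pt N i j) (pt N i.+1 j) (pt N i.+1 j.+1) (pt N i j.+1)
    (scU N i j) (scV N i.+1 j) (scU N i j.+1) (scV N i j).
  split; first exact: scU_edge parN hi (ltnW hj).
  - exact: scV_edge parN hi hj.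
  - by rewrite -opprB -[pt P i j.+1 - _]opprB scalerN; congr (- _);
       exact: scU_edge parN hi hj.
  - by rewrite -opprB -[pt P i j - _]opprB scalerN; congr (- _);
       exact: scV_edge parN (ltnW hi) hj.
have [e1 e2] := scaled_face_closed sh SF.
apply: face_parameter => //.
have [g g0 [E1 E2]] := scaled_face_area sh SF u0 v0 u1 v1.
apply: (mulIf (lt0r_neq0 g0)); rewrite -E1 -E2.
by have := areaN i j hi hj; rewrite /face_area => ->.
Qed.

Lemma close_sc_inj (N N' : grid R d m n) i j :
  close_face N i j -> close_face N' i j -> 0 < face_param N i j ->
  0 < face_param N' i j -> 0 < a i j -> 0 < b i j ->
  [/\ sc (a i j) (face_param N i j) = sc (a i j) (face_param N' i j) ->
        face_param N i j = face_param N' i j,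
      sc (a i j)^-1 (face_param N i j) = sc (a i j)^-1 (face_param N' i j) ->
        face_param N i j = face_param N' i j,
      sc (b i j) (face_param N i j)^-1 = sc (b i j) (face_param N' i j)^-1 ->
        face_param N i j = face_param N' i j &
      sc (b i j)^-1 (face_param N i j)^-1 = sc (b i j)^-1 (face_param N' i j)^-1 ->
        face_param N i j = face_param N' i j].
Proof.
move=> [_ c1 c2 c3 c4] [_ c1' c2' c3' c4'] x0 x'0 a0 b0.
have a0V : 0 < (a i j)^-1 by rewrite invr_gt0.
have b0V : 0 < (b i j)^-1 by rewrite invr_gt0.
have x0V : 0 < (face_param N i j)^-1 by rewrite invr_gt0.
have x'0V : 0 < (face_param N' i j)^-1 by rewrite invr_gt0.
split; first exact: (sc_inj a0 x0 x'0 c1 c1').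
- exact: (sc_inj a0V x0 x'0 c2 c2').
- by move=> /(sc_inj b0 x0V x'0V c3 c3') /invr_inj.
- by move=> /(sc_inj b0V x0V x'0V c4 c4') /invr_inj.
Qed.

(** The main point is [flex_inj]. If two members have equal times in one face, the common edges and
    the injectivity of [sc] near 1 spread this equality to all faces; all edges then agree, the
    members are translates of each other, and non-congruence identifies the parameters. *)
Lemma family_flexible (N : R -> grid R d m n) (D : set R) :
  infinite_set D ->
  (forall t, D t -> parallel_nets P (N t) /\ same_face_areas P (N t)) ->
  (forall t, D t -> forall i j, (i < m)%N -> (j < n)%N -> close_face (N t) i j) ->
  (forall s t, D s -> D t -> congruent_nets (N s) (N t) -> s = t) ->
  flexible m n a b D (fun t => face_param (N t)).
Proof.
move=> infD parN clN congN.
have a0 i j : (i < m)%N -> (j < n)%N -> 0 < a i j.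
  by move=> hi hj; have [] := shP hi hj.
have b0 i j : (i < m)%N -> (j < n)%N -> 0 < b i j.
  by move=> hi hj; have [] := shP hi hj.
have spec t i j : D t -> (i < m)%N -> (j < n)%N -> _ :=
  fun Dt hi hj => face_param_spec (parN t Dt).1 (parN t Dt).2 (clN t Dt i j hi hj) hi hj.
pose X t i j := face_param (N t) i j.
have X0 t i j : D t -> (i < m)%N -> (j < n)%N -> 0 < X t i j.
  by move=> Dt hi hj; have [] := spec t i j Dt hi hj.
have cU t i j : D t -> (i < m)%N -> (j.+1 < n)%N ->
    sc (a i j)^-1 (X t i j) = sc (a i j.+1) (X t i j.+1).
  move=> Dt hi hj; have [_ _ _ <- _] := spec t i j Dt hi (ltnW hj).
  by have [_ <- _ _ _] := spec t i j.+1 Dt hi hj.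
have cV t i j : D t -> (i.+1 < m)%N -> (j < n)%N ->
    sc (b i j) (X t i j)^-1 = sc (b i.+1 j)^-1 (X t i.+1 j)^-1.
  move=> Dt hi hj; have [_ _ <- _ _] := spec t i j Dt (ltnW hi) hj.
  by have [_ _ _ _ <-] := spec t i.+1 j Dt hi hj.
have inj s t i j : D s -> D t -> (i < m)%N -> (j < n)%N -> _ :=
  fun Ds Dt hi hj => close_sc_inj (clN s Ds i j hi hj) (clN t Dt i j hi hj)
    (X0 s i j Ds hi hj) (X0 t i j Dt hi hj) (a0 i j hi hj) (b0 i j hi hj).
split => //.
- move=> i0 j0 hi0 hj0 s t /set_mem Ds /set_mem Dt E0.
  have E i j : (i < m)%N -> (j < n)%N -> X s i j = X t i j.
    move=> hi; move: j; apply: (@iff_const n _ j0 hj0) => [j hj|].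
      have [_ i1 _ _] := inj s t i j Ds Dt hi (ltnW hj).
      have [i2 _ _ _] := inj s t i j.+1 Ds Dt hi hj.
      split=> Ej; [apply: i2 | apply: i1]; rewrite -/(X _ _ _) -/(X _ _ _).
        by rewrite -!cU // Ej.
      by rewrite !cU // Ej.
    move: i hi; apply: (@iff_const m _ i0 hi0) => // i hi.
    have [_ _ i1 _] := inj s t i j0 Ds Dt (ltnW hi) hj0.
    have [_ _ _ i2] := inj s t i.+1 j0 Ds Dt hi hj0.
    split=> Ei; [apply: i2 | apply: i1]; rewrite -/(X _ _ _) -/(X _ _ _).
      by rewrite -!cV // Ei.
    by rewrite !cV // Ei.
  apply: congN => //; apply: congruent_translate => i j hi hj.
    rewrite (scU_edge (parN s Ds).1 hi hj) (scU_edge (parN t Dt).1 hi hj); congr (_ *: _).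
    case: j hj => [|j] hj.
      have [_ -> _ _ _] := spec s i 0%N Ds hi n0.
      have [_ -> _ _ _] := spec t i 0%N Dt hi n0.
      by rewrite -/(X _ _ _) E.
    have [_ _ _ -> _] := spec s i j Ds hi hj.
    have [_ _ _ -> _] := spec t i j Dt hi hj.
    by rewrite -/(X _ _ _) E.
  rewrite (scV_edge (parN s Ds).1 hi hj) (scV_edge (parN t Dt).1 hi hj); congr (_ *: _).
  case: i hi => [|i] hi.
    have [_ _ _ _ ->] := spec s 0%N j Ds m0 hj.
    have [_ _ _ _ ->] := spec t 0%N j Dt m0 hj.
    by rewrite -/(X _ _ _) E.
  have [_ _ -> _ _] := spec s i j Ds hi hj.
  have [_ _ -> _ _] := spec t i j Dt hi hj.
  by rewrite -/(X _ _ _) E.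
- by move=> t Dt; split => i j hi hj; [apply: cU | apply: cV].
- move=> t i j Dt hi hj E; have := cU t i j Dt hi hj.
  have [_ _ c1 _ _] := clN t Dt i j hi (ltnW hj).
  have [_ c2 _ _ _] := clN t Dt i j.+1 hi hj.
  rewrite E in c1 *; apply: sc_inj => //; try exact: X0; first exact: a0.
  exact: X0 (ltnW hj).
- move=> t i j Dt hi hj E; have := cV t i j Dt hi hj.
  have [_ _ _ c1 _] := clN t Dt i j (ltnW hi) hj.
  have [_ _ _ _ c2] := clN t Dt i.+1 j hi hj.
  rewrite -E in c2 * => /(sc_inj _ _ _ c1 c2) H; apply: invr_inj; apply: H.
  + exact: b0 (ltnW hi) hj.
  + by rewrite invr_gt0; apply: X0 (ltnW hi) hj.
  + by rewrite invr_gt0; apply: X0 hi hj.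
Qed.

(** Only members close to the given net are kept. Continuity at [t0], where every scale and every
    time is 1, provides infinitely many of them. *)
Lemma deformable_flexible : deformable P ->
  exists D X, flexible m n a b D X.
Proof.
move=> [N [[t0 t01 NP] cN _ parN congN]].
have PE i j : pt (N t0) i j = pt P i j by rewrite /pt NP.
pose I := `[0 : R, 1]%classic.
have It0 : I t0 by [].
have cpt i j : pt (N t) i j @[t --> within I (nbhs t0)] --> pt P i j.
  rewrite -PE /pt.
  by have /subspace_continuousP/(_ t0 It0) := cN (inord i) (inord j).
have FF : Filter (within I (nbhs t0)) by apply: within_filter.
have cU i j : (i < m)%N -> (j <= n)%N ->
    scU (N t) i j @[t --> within I (nbhs t0)] --> (1 : R).
  move=> hi hj; rewrite -(ratio_scale 1 (edgeU_neq0 n0 shP hi hj)) scale1r.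
  by apply: ratio_cvg; apply: cvgB; apply: cpt.
have cV i j : (i <= m)%N -> (j < n)%N ->
    scV (N t) i j @[t --> within I (nbhs t0)] --> (1 : R).
  move=> hi hj; rewrite -(ratio_scale 1 (edgeV_neq0 m0 shP hi hj)) scale1r.
  by apply: ratio_cvg; apply: cvgB; apply: cpt.
have cl : \forall t \near within I (nbhs t0), forall i j, (i < m)%N -> (j < n)%N ->
    close_face (N t) i j.
  apply: (@near_all_ltn2 _ (within I (nbhs t0)) _ m n) => i j hi hj.
  have [a0 b0 _ _] := shP hi hj; have [an bn abn ab1n] := shape_neq0 a0 b0.
  have cX : face_param (N t) i j @[t --> within I (nbhs t0)] --> (1 : R).
    rewrite [X in _ --> X](_ : (1 : R) =
      ((b i j + 1) * 1 + (a i j - 1) * 1) / (a i j + b i j)); last by field.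
    apply: cvgMl; apply: cvgD; apply: cvgMr.
      exact: cU hi (ltnW hj).
    exact: cV hi hj.
  have cXV : (face_param (N t) i j)^-1 @[t --> within I (nbhs t0)] --> (1 : R).
    by rewrite -[X in _ --> X]invr1; apply: cvgV => //; rewrite oner_eq0.
  have lt1 (x : R) : 0 < x -> 1 - x / 2 < 1.
    by move=> x0; rewrite gtrDl oppr_lt0 divr_gt0.
  have gt (f : R -> R) (x : R) : f t @[t --> within I (nbhs t0)] --> (1 : R) ->
      x < 1 -> \forall t \near within I (nbhs t0), x < f t.
    by move=> cf x1; apply: (cvgr_gt 1 cf).
  have n1 := gt _ _ (cU i j hi (ltnW hj)) ltr01.
  have n2 := gt _ _ (cV i.+1 j hi hj) ltr01.
  have n3 := gt _ _ (cU i j.+1 hi hj) ltr01.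
  have n4 := gt _ _ (cV i j (ltnW hi) hj) ltr01.
  have n5 := gt _ _ cX (lt1 _ a0).
  have n6 := gt _ _ cX (lt1 (a i j)^-1 (etrans (invr_gt0 _) a0)).
  have n7 := gt _ _ cXV (lt1 _ b0).
  have n8 := gt _ _ cXV (lt1 (b i j)^-1 (etrans (invr_gt0 _) b0)).
  by near=> t; split; [split|..]; near: t.
exists [set t | t \in `[0, 1] /\
  forall i j, (i < m)%N -> (j < n)%N -> close_face (N t) i j], (fun t => face_param (N t)).
apply: family_flexible.
- exact: (infinite_near_within t01 cl).
- move=> t [ht _]; have [[pU pV] ar] := parN t0 t t01 ht.
  split; last by move=> i j hi hj; rewrite -ar // /face_area !PE.
  by split=> i j hi hj; [have := pU i j hi hj | have := pV i j hi hj]; rewrite !PE.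
- by move=> t [].
- move=> s t [hs _] [ht _] C; apply/eqP; apply/negP => /negP st.
  exact: congN s t hs ht st C.
Unshelve. all: by end_near. Qed.

End Forward.

Lemma net_shape (R : realType) (d m n : nat) (P : grid R d m n) : is_net P ->
  exists a b, shape_net P a b.
Proof.
move=> hP; have : forall p : nat * nat, exists ab : R * R,
    (p.1 < m)%N -> (p.2 < n)%N ->
    shape (pt P p.1 p.2) (pt P p.1.+1 p.2) (pt P p.1.+1 p.2.+1) (pt P p.1 p.2.+1)
      ab.1 ab.2.
  move=> [i j] /=; have [hi|hi] := boolP (i < m)%N; last by exists (0, 0).
  have [hj|hj] := boolP (j < n)%N; last by exists (0, 0).
  by have [x [y H]] := convex_quad_shape (hP i j hi hj); exists (x, y).
move=> /choice[f fP].
exists (fun i j => (f (i, j)).1), (fun i j => (f (i, j)).2) => i j hi hj.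
exact: (fP (i, j)).
Qed.

Theorem theorem3p1 (R : realType) (d m n : nat) (hm : (0 < m)%N) (hn : (0 < n)%N)
    (P : grid R d m n) (hP : is_net P) :
  deformable P <->
  (each_subnet12 (faces12 (@affine_symmetric R d)) P \/
   each_subnet21 (faces21 (@affine_symmetric R d)) P) \/
  (each_subnet12 (faces12 (@equal_opposite_ratios R d)) P /\
   each_subnet21 (faces21 (@equal_opposite_ratios R d)) P).
Proof.
have [a [b shP]] := net_shape hP.
rewrite (affine12P shP) (affine21P shP) (ratios12P shP) (ratios21P shP).
split=> [/(deformable_flexible hm hn shP)[D [X /flexible_classification]]|H].
  by case=> H; [left; left | left; right | right].
have [X gX] : exists X, deformation_family m n a b X.
  apply: deformation_family_exists => [i j hi hj|i j hi hj|].
  - by have [] := shP i j hi hj.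
  - by have [] := shP i j hi hj.
  - by case: H => [[H|H]|H]; [constructor 1 | constructor 2 | constructor 3].
exact: (deformation_family_deformable shP) gX.
Qed.
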